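(* Let $h:\Sigma^c\to\mathcal R$ be a random tornado tabulation hash function with $d$ derived characters. For any fixed set $X\subseteq\Sigma^c$ with $|X|\le|\Sigma|/2$, with probability at least $$1-7|X|^3\left(\frac{3}{|\Sigma|}\right)^{d+1}-\frac{1}{2^{|\Sigma|/2}},$$ $h$ is fully random on $X$, i.e. $h|_X$ is uniformly distributed over $\mathcal R^X$.
   Context: Let $\Sigma=\{0,1,\dots,2^k-1\}$ be an alphabet of characters, identified with $k$-bit strings, where $\oplus$ denotes bitwise xor; throughout $|\Sigma|\ge 2^8$. Let $\mathcal R=\{0,\dots,2^r-1\}$, viewed as $r$-bit strings. For $b\ge1$, a simple tabulation hash function $g:\Sigma^b\to\mathcal R'$ (with $\mathcal R'$ a set of bit strings) is $g(x_1\cdots x_b)=T_1[x_1]\oplus\cdots\oplus T_b[x_b]$, where $T_1,\dots,T_b:\Sigma\to\mathcal R'$ are independent fully random tables. A random tornado tabulation hash function $h:\Sigma^c\to\mathcal R$ with $d\ge1$ derived characters consists of mutually independent simple tabulation functions $\tilde h_i:\Sigma^{c+i-1}\to\Sigma$ for $i=0,\dots,d$ and $\hat h:\Sigma^{c+d}\to\mathcal R$. For a key $x=x_1\cdots x_c$, its derived key is $\tilde h(x)=\tilde x_1\cdots\tilde x_{c+d}\in\Sigma^{c+d}$ with $\tilde x_i=x_i$ for $i<c$, $\tilde x_c=x_c\oplus\tilde h_0(\tilde x_1\cdots\tilde x_{c-1})$, and $\tilde x_i=\tilde h_{i-c}(\tilde x_1\cdots\tilde x_{i-1})$ for $c<i\le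 c+d$. Then $h(x)=\hat h(\tilde h(x))$. *)

(* Defs.v *)
From mathcomp Require Import all_boot all_order all_algebra.
Set Implicit Arguments. Unset Strict Implicit. Unset Printing Implicit Defensive.
Import Order.TTheory GRing.Theory Num.Theory.
Local Open Scope ring_scope.

(* Alphabet Sigma = k-bit strings; bitwise xor = addition in F_2^k. *)
Definition Sigma (k : nat) := 'rV['F_2]_k.
Definition Rng (r : nat) := 'rV['F_2]_r.
Definition Key (k c : nat) := {ffun 'I_c -> Sigma k}.

(* Index set of the derived tables: pair (i, p) with i in 0..d and
   p a (0-indexed) position of the input of \tilde h_i : Sigma^(c+i-1) -> Sigma,
   i.e. p < c + i - 1. *)
Definition DIdx (c d : nat) :=
  {ip : 'I_d.+1 * 'I_(c + d) | (ip.2 + 1 < c + ip.1)%N}.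

Definition DTables (k c d : nat) := {ffun DIdx c d -> {ffun Sigma k -> Sigma k}}.
Definition HTables (k r c d : nat) := {ffun 'I_(c + d) -> {ffun Sigma k -> Rng r}}.

Definition dchar (k c d : nat) (T : DTables k c d) (i : nat) (s : seq (Sigma k))
  : Sigma k :=
  \sum_(q : DIdx c d | (val q).1 == i :> nat) T q (nth 0 s (val q).2).

Definition derived_seq (k c d : nat) (T : DTables k c d) (x : Key k c)
  : seq (Sigma k) :=
  let xs := [seq x j | j <- enum 'I_c] in
  let s0 := take c.-1 xs in
  let s1 := rcons s0 (nth 0 xs c.-1 + dchar T 0 s0) in
  foldl (fun s i => rcons s (dchar T i s)) s1 (iota 1 d).

Definition derived_key (k c d : nat) (T : DTables k c d) (x : Key k c)
  : {ffun 'I_(c + d) -> Sigma k} :=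
  [ffun j : 'I_(c + d) => nth 0 (derived_seq T x) j].

Definition hhat (k r c d : nat) (H : HTables k r c d)
  (y : {ffun 'I_(c + d) -> Sigma k}) : Rng r :=
  \sum_(j : 'I_(c + d)) H j (y j).

Definition tornado (k r c d : nat) (T : DTables k c d) (H : HTables k r c d)
  (x : Key k c) : Rng r :=
  hhat H (derived_key T x).

(* Given the derived tables T, h|_X is uniformly distributed over R^X when
   \hat h is drawn uniformly at random: every f : X -> R is hit with
   probability exactly |R|^(-|X|). *)
Definition fully_random_on (k r c d : nat) (T : DTables k c d) (X : {set Key k c})
  : Prop :=
  forall f : {ffun Key k c -> Rng r},
    (#|[set H : HTables k r c d | [forall x in X, tornado T H x == f x]]|
       * #|{: Rng r}| ^ #|X|)%N = #|{: HTables k r c d}|.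

(* Main.v *)
From Stdlib Require Import ZArith.
Require Import Defs.
From mathcomp Require Import all_boot all_order all_algebra.
From mathcomp Require Import ssrZ zify ring lra.
Set Implicit Arguments. Unset Strict Implicit. Unset Printing Implicit Defensive.
Import Order.TTheory GRing.Theory Num.Theory.
Local Open Scope ring_scope.

(** Write s = |Sigma|, n = |X|, and call the characters c, ..., c + d of a derived
    key its levels 0, ..., d.  If no nonempty subset of X is a zero set (every
    position character of its derived keys occurs an even number of times), then
    the derived keys are linearly independent over F_2 and h is fully random on X;
    so it suffices to bound the probability that a zero set exists.

    Basic estimate: pairs of keys whose differences below level i are linearly
    independent agree at level i with probability s^-1 each, independently.

    A fixed set of 2b keys is a zero set below level j with probability at most
    G(b) (3/s)^j: match its keys at level j - 1, one after the other, until the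
    matched pairs become dependent; the dependent pairs form a zero set below
    level j - 1, and one concludes by induction.

    For the two top levels, take a zero set Z of least size with matchings sigma,
    tau at levels d and d - 1, and follow the alternating paths of sigma and tau.
    A shortest collection of one path and some closed cycles whose tau-pairs are
    dependent contains a zero set S below level d; except for one tau-pair, all
    its pairs are independent, so l tau-pairs cost s^(-2(l-1)), against at most
    n^(2l-1) choices of keys, since the sum over S of the keys vanishes.  As
    n <= s/2 these contributions form a geometric series, whose sum is below
    63 n^3 s^-2 (3/s)^(d-1) = 7 n^3 (3/s)^(d+1). *)

(** * Words over a finite list, masks and the union bound *)

Section Lists.
Variable A : eqType.

Fixpoint lists (s : seq A) n : seq (seq A) :=
  if n is n'.+1 then [seq a :: l | a <- s, l <- lists s n'] else [:: [::]].

Lemma mem_lists s n (l : seq A) :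
  (l \in lists s n) = (size l == n) && all (mem s) l.
Proof.
elim: n l => [|n IHn] [|a l] //=.
  by apply/negP => /allpairsP[[b l'] /= []].
apply/allpairsP/idP => [[[b l'] /= [bs ls [-> ->]]]|/and3P[sl al ll]].
  by move: ls; rewrite IHn eqSS => /andP[-> ->]; rewrite andbT /= bs.
by exists (a, l); split; rewrite //= IHn -eqSS sl.
Qed.

(** Distributivity: it yields the binomial sums over masks and, later, the geometric series over
    walks. *)
Lemma sum_lists (R : comPzRingType) (F : A -> R) s n :
  \sum_(l <- lists s n) \prod_(a <- l) F a = (\sum_(a <- s) F a) ^+ n.
Proof.
elim: n => [|n IHn] /=; first by rewrite big_seq1 big_nil.
rewrite big_allpairs_dep exprS -IHn big_distrl /=; apply: eq_bigr => a _.
by rewrite big_distrr /=; apply: eq_bigr => l _; rewrite big_cons.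
Qed.

End Lists.

Definition masks := lists [:: true; false].

Lemma mem_masks n (m : bitseq) : (m \in masks n) = (size m == n).
Proof. by rewrite mem_lists; case: eqP => //= _; apply/allP => -[]. Qed.

Definition flat (A : Type) (E : seq (A * A)) : seq A :=
  flatten [seq [:: e.1; e.2] | e <- E].

Lemma flat_cat (A : Type) (E F : seq (A * A)) : flat (E ++ F) = flat E ++ flat F.
Proof. by rewrite /flat map_cat flatten_cat. Qed.

Lemma size_flat (A : Type) (E : seq (A * A)) : size (flat E) = (size E).*2.
Proof. by elim: E => //= e E IHE; rewrite /flat /= -/(flat E) IHE doubleS. Qed.

Lemma flat_mask_subseq (A : eqType) m (E : seq (A * A)) :
  subseq (flat (mask m E)) (flat E).
Proof.
elim: E m => [|e E IHE] [|[] m] //=.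
  by rewrite /flat /= !eqxx; apply: IHE.
exact: subseq_trans (IHE m) (suffix_subseq [:: e.1; e.2] _).
Qed.

Lemma union_bound (U : finType) (I : Type) (r : seq I) (P : pred U)
    (Q : I -> pred U) :
  (forall T, P T -> has (fun i => Q i T) r) ->
  (#|[set T | P T]| <= \sum_(i <- r) #|[set T | Q i T]|)%N.
Proof.
elim: r P => [|i r IHr] P PQ.
  rewrite big_nil leqn0 cards_eq0; apply/eqP/setP => T; rewrite !inE.
  by apply/negP => /PQ.
rewrite big_cons.
(* The induction continues with the part of [P] that [Q i] does not cover. *)
have := IHr (fun T => P T && ~~ Q i T) _; move=> /(_ _)/wrap[].
  by move=> T /andP[/PQ /=]; case: (Q i T).
move=> le; apply: leq_trans (leq_add (leqnn _) le).
rewrite -cardsUI; apply: leq_trans (leq_addr _ _).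
by apply/subset_leq_card/subsetP => T; rewrite !inE => ->; case: (Q i T).
Qed.

(** * Dual families over F_2 *)

Section Dual.
Variables (I : finType) (m k : nat).
Implicit Types (w : {ffun 'I_m -> {ffun I -> 'F_2}}) (u : {ffun 'I_m -> 'rV['F_2]_k}).

Definition fam_mx w := \matrix_(i < m, j < #|I|) w i (enum_val j).

(* Explicit in [w], so that equal families get equal duals. *)
Definition dual w u (j : I) : 'rV['F_2]_k :=
  \sum_i pinvmx (fam_mx w) (enum_rank j) i *: u i.

(** A free family has a matrix of full row rank, whose pseudo-inverse is a right inverse. *)
Lemma dualE w u :
  (forall a : 'I_m -> 'F_2, (forall j, \sum_i a i * w i j = 0) ->
    forall i, a i = 0) ->
  forall i, \sum_j w i j *: dual w u j = u i.
Proof.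
move=> free_w i.
have free_mx : row_free (fam_mx w).
  rewrite -kermx_eq0; apply/rowV0P => v /sub_kermxP v0.
  apply/rowP => i0; rewrite mxE; apply: (free_w (fun i => v 0 i)).
  move=> j; have := congr1 (fun M : 'rV_ _ => M 0 (enum_rank j)) v0.
  rewrite !mxE => v0j; rewrite -[RHS]v0j.
  by apply: eq_bigr => i1 _; rewrite !mxE enum_rankK.
have := mulmxVp free_mx => /matrixP inv.
transitivity (\sum_(i0 < m) (fam_mx w *m pinvmx (fam_mx w)) i i0 *: u i0).
  under eq_bigr => j _ do rewrite scaler_sumr.
  rewrite exchange_big /=; apply: eq_bigr => i0 _; rewrite mxE scaler_suml.
  rewrite (reindex_onto enum_val enum_rank) => [|j _]; last exact: enum_rankK.
  rewrite (eq_bigl predT) => [|j]; last by rewrite enum_valK eqxx.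
  by apply: eq_bigr => j _; rewrite scalerA [fam_mx w i j]mxE enum_valK.
rewrite (bigD1 i) //= [X in X *: _]inv mxE eqxx scale1r big1 ?addr0 // => j ji.
by rewrite [X in X *: _]inv mxE eq_sym (negbTE ji) scale0r.
Qed.

End Dual.

(** * Characters and linear independence *)

Section Levels.
Variables (k c d : nat).
Hypothesis c_gt0 : (0 < c)%N.
Notation Sg := (Sigma k).
Notation K := (Key k c).
Notation U := (DTables k c d).
Implicit Types (T : U) (x y : K) (E : seq (K * K)).

(** Positions count from 0: those below [c.-1] carry plain characters, and level [i] sits at
    position [c.-1 + i]. *)
Definition dk T x p : Sg := nth 0 (derived_seq T x) p.

Definition xch x p : Sg := nth 0 [seq x z | z <- enum 'I_c] p.

Lemma xchE x (p : 'I_c) : xch x p = x p.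
Proof. by rewrite /xch (nth_map p) ?size_enum_ord // nth_ord_enum. Qed.

Lemma dchar_ext T i (s t : seq Sg) :
  (forall p, (p + 1 < c + i)%N -> nth 0 s p = nth 0 t p) ->
  dchar T i s = dchar T i t.
Proof.
by move=> st; apply: eq_bigr => q /eqP qi; rewrite st // -qi; case: q {qi}.
Qed.

(** The fold of [derived_seq] stopped after [n] rounds; the two are convertible at [n = d]. *)
Let ds T x (n : nat) := foldl (fun t i => rcons t (dchar T i t))
  (rcons (take c.-1 [seq x z | z <- enum 'I_c])
     (xch x c.-1 + dchar T 0 (take c.-1 [seq x z | z <- enum 'I_c]))) (iota 1 n).

Let dsS T x n : ds T x n.+1 = rcons (ds T x n) (dchar T n.+1 (ds T x n)).
Proof.
have iotaS : iota 1 n.+1 = rcons (iota 1 n) n.+1.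
  by rewrite -cats1 -[n.+1 in LHS]addn1 iotaD add1n.
by rewrite /ds iotaS foldl_rcons.
Qed.

Let size_take_x x : size (take c.-1 [seq x z | z <- enum 'I_c]) = c.-1.
Proof. by rewrite size_takel // size_map size_enum_ord leq_pred. Qed.

Let size_ds T x n : size (ds T x n) = (c + n)%N.
Proof.
elim: n => [|n IHn]; last by rewrite dsS size_rcons IHn addnS.
by rewrite /ds /= size_rcons size_take_x prednK // addn0.
Qed.

Let nth_ds T x n m p : (n <= m)%N -> (p < c + n)%N ->
  nth 0 (ds T x m) p = nth 0 (ds T x n) p.
Proof.
move=> nm pn; elim: m nm => [|m IHm]; first by rewrite leqn0 => /eqP->.
rewrite leq_eqVlt => /orP[/eqP<-//|]; rewrite ltnS => nm.
by rewrite dsS nth_rcons size_ds (leq_trans pn) ?leq_add2l // IHm.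
Qed.

Lemma dk_lt T x p : (p < c.-1)%N -> dk T x p = xch x p.
Proof.
move=> pc; rewrite /dk -/(ds T x d) (@nth_ds T x 0) //; last by lia.
by rewrite /ds /= nth_rcons size_take_x pc nth_take.
Qed.

Lemma dk_level T x i : (i <= d)%N ->
  dk T x (c.-1 + i) = (if i == 0%N then xch x c.-1 else 0) +
    \sum_(q : DIdx c d | (val q).1 == i :> nat) T q (dk T x (val q).2).
Proof.
move=> id; rewrite /dk -/(ds T x d) (@nth_ds T x i) //; last by lia.
case: i id => [|i] id.
  rewrite /ds /= addn0 nth_rcons size_take_x ltnn eqxx; congr (_ + _).
  apply: dchar_ext => p pc; rewrite addn0 in pc; have pc' : (p < c.-1)%N by lia.
  by rewrite -/(dk T x p) dk_lt // nth_take.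
rewrite add0r dsS nth_rcons size_ds.
have -> : (c.-1 + i.+1 = c + i)%N by lia.
rewrite ltnn eqxx; apply: dchar_ext => p pc.
by rewrite (@nth_ds T x i d) //; lia.
Qed.

Lemma sum_level (V : nmodType) i (phi : 'I_(c + d) -> V) : (i <= d)%N ->
  \sum_(q : DIdx c d | (val q).1 == i :> nat) phi (val q).2 =
  \sum_(p < c + d | (p + 1 < c + i)%N) phi p.
Proof.
move=> id.
have i_lt : (i < d.+1)%N by [].
rewrite [RHS](reindex_omap (fun q : DIdx c d => (val q).2)
  (fun p => insub (Ordinal i_lt, p))) => [|p pi]; last first.
  by rewrite insubT.
apply: eq_bigl => q /=; apply/eqP/andP => [qi|[qi]].
  have qi' : ((val q).2 + 1 < c + i)%N by rewrite -qi; case: q {qi}.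
  split=> //; apply/eqP; rewrite insubT; congr Some; apply: val_inj => /=.
  by case: q qi {qi'} => -[q1 q2] h /= qi; congr (_, _); apply: val_inj.
by rewrite insubT => /eqP[<-].
Qed.

(** Indicator of the position characters below level [i]; the test [p + 1 < c + i] selects the input
    positions of the level-[i] hash function. A zero set below level [i] is one whose vectors have
    sum 0 under [V T i]. *)
Definition vec T (i : nat) x : {ffun 'I_(c + d) * Sg -> 'F_2} :=
  [ffun ps : 'I_(c + d) * Sg => ((ps.1 + 1 < c + i)%N && (dk T x ps.1 == ps.2))%:R].


Definition V T i s := \sum_(x <- s) vec T i x.

Lemma V_nil T i : V T i [::] = 0. Proof. exact: big_nil. Qed.
Lemma V_cons T i x s : V T i (x :: s) = vec T i x + V T i s.
Proof. exact: big_cons. Qed.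
Lemma V_cat T i s t : V T i (s ++ t) = V T i s + V T i t.
Proof. exact: big_cat. Qed.
Lemma V_perm T i s t : perm_eq s t -> V T i s = V T i t.
Proof. exact: perm_big. Qed.

(** Dependence on the tables below level [i] alone is expressed as invariance under [agree i]; this
    takes the place of probabilistic independence. *)
Definition agree i T T' := forall q : DIdx c d, ((val q).1 < i)%N -> T q = T' q.

Lemma agree_dk i T T' x p : agree i T T' -> (p < c + d)%N -> (p + 1 < c + i)%N ->
  dk T x p = dk T' x p.
Proof.
move=> TT'; elim/ltn_ind: p => p IHp pcd pci.
have [pc|cp] := ltnP p c.-1; first by rewrite !dk_lt.
have -> : p = (c.-1 + (p - c.-1))%N by lia.
rewrite !dk_level; try lia; congr (_ + _); apply: eq_bigr => q /eqP qp.
have q2 : ((val q).2 + 1 < c + (val q).1)%N by case: q {qp}.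
have /andP[q2p q2i] : ((val q).2 < p)%N && ((val q).2 + 1 < c + i)%N.
  by move: q2; rewrite qp; case: (val q).2 => z /= _; lia.
by rewrite TT' ?IHp // qp; lia.
Qed.

Lemma agree_vec i T T' : agree i T T' -> vec T i =1 vec T' i.
Proof.
move=> TT' x; apply/ffunP => -[p a]; rewrite !ffunE /=.
by case: ltnP => //= pc; rewrite (agree_dk x TT').
Qed.

Lemma agree_V i T T' : agree i T T' -> V T i =1 V T' i.
Proof. by move=> TT' s; apply: eq_bigr => x _; apply: agree_vec. Qed.

Lemma agree_le i j T T' : (j <= i)%N -> agree i T T' -> agree j T T'.
Proof. by move=> ji TT' q qj; apply: TT'; apply: leq_trans ji. Qed.

Definition sat T i E :=
  all (fun e => dk T e.1 (c.-1 + i) == dk T e.2 (c.-1 + i)) E.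

(** Linear independence over F_2 of the differences of the pairs, in a recursive form suited to
    adding a pair at the head. In characteristic 2 a difference is a sum, so [V] of the flattened
    pairs computes it. *)
Fixpoint ind T i E := if E is e :: E' then
  all (fun m => V T i (flat (e :: mask m E')) != 0) (masks (size E'))
    && ind T i E' else true.

Lemma agree_ind i T T' E : agree i T T' -> ind T i E = ind T' i E.
Proof.
move=> TT'; elim: E => //= e E ->; congr (_ && _).
by apply: eq_all => m; rewrite (agree_V TT').
Qed.

Lemma agree_sat i T T' E : (i <= d)%N -> agree i.+1 T T' -> sat T i E = sat T' i E.
Proof.
by move=> id TT'; apply: eq_all => e; rewrite !(agree_dk _ TT') //; lia.
Qed.

Lemma ind_mask T i E m : ind T i E -> size m = size E ->
  V T i (flat (mask m E)) = 0 -> ~~ has id m.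
Proof.
elim: E m => [|e E IHE] [|b m] //= /andP[/allP inde indE] [] sm.
case: b => /= [V0|]; last exact: IHE.
by have := inde m; rewrite mem_masks sm eqxx V0 eqxx => /(_ isT).
Qed.

Definition fam T i E : {ffun 'I_(size E) -> {ffun 'I_(c + d) * Sg -> 'F_2}} :=
  [ffun j => V T i (flat [:: tnth (in_tuple E) j])].

Lemma F2_scale (W : lmodType 'F_2) (a : 'F_2) (v : W) :
  a *: v = if a != 0 then v else 0.
Proof.
have [->|a0] := eqVneq a 0; first exact: scale0r.
suff -> : a = 1 by rewrite scale1r.
by apply: val_inj; case: a a0 => -[|[|]].
Qed.

Lemma V_flat_mask T i E m (e0 : K * K) : size m = size E ->
  V T i (flat (mask m E)) =
  \sum_(j < size E) if nth false m j then V T i (flat [:: nth e0 E j]) else 0.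
Proof.
elim: E m => [|e E IHE] [|b m] //=; first by rewrite V_nil big_ord0.
move=> [sm]; rewrite big_ord_recl /= -IHE //; case: b; rewrite ?add0r //.
by rewrite -V_cat -flat_cat.
Qed.

(** Over F_2 a linear combination is a choice of a subfamily, here the mask of nonzero
    coefficients. *)
Lemma fam_free T i E : ind T i E ->
  forall a : 'I_(size E) -> 'F_2, (forall ps, \sum_j a j * fam T i E j ps = 0) ->
  forall j, a j = 0.
Proof.
move=> indE a a0 j; apply/eqP/negPn/negP => aj.
pose m := [seq a j != 0 | j <- enum 'I_(size E)].
have sm : size m = size E by rewrite size_map size_enum_ord.
suff V0 : V T i (flat (mask m E)) = 0.
  have /negP[] := ind_mask indE sm V0; apply/hasP; exists true => //.
  by apply/mapP; exists j; rewrite ?mem_enum ?aj.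
rewrite (V_flat_mask _ _ (tnth (in_tuple E) j)) //.
apply/ffunP => ps; rewrite sum_ffunE [RHS]ffunE -[RHS](a0 ps).
apply: eq_bigr => l _; rewrite [fam _ _ _ _]ffunE.
rewrite (nth_map l) ?size_enum_ord // nth_ord_enum -[RHS]/(a l *: (_ : ('F_2)^o)).
rewrite F2_scale; case: ifP => _; last by rewrite ffunE.
by rewrite [in RHS](tnth_nth (tnth (in_tuple E) j)).
Qed.

Definition shift i (S : 'I_(c + d) * Sg -> Sg) : U :=
  [ffun q : DIdx c d => [ffun a => if (val q).1 == i :> nat then S ((val q).2, a) else 0]].

Lemma agree_shift i S T : agree i (T + shift i S) T.
Proof.
move=> q qi; apply/ffunP => a; rewrite !ffunE.
by rewrite (ltn_eqF qi) addr0.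
Qed.

(** Level [i] is additive in its own tables, and its inputs lie below level [i], where the shift
    changes nothing. *)
Lemma dk_shift i S T x : (i <= d)%N ->
  dk (T + shift i S) x (c.-1 + i) =
  dk T x (c.-1 + i) + \sum_ps vec T i x ps *: S ps.
Proof.
move=> id; rewrite !dk_level // -addrA; congr (_ + _).
have -> : \sum_ps vec T i x ps *: S ps =
    \sum_p \sum_a vec T i x (p, a) *: S (p, a).
  by rewrite pair_bigA; apply: eq_bigr => -[].
transitivity (\sum_(q : DIdx c d | (val q).1 == i :> nat)
   (T q (dk T x (val q).2) + S ((val q).2, dk T x (val q).2))).
  apply: eq_bigr => q /eqP qi; have q2 : ((val q).2 + 1 < c + i)%N.
    by rewrite -qi; case: q {qi}.
  rewrite (agree_dk x (agree_shift (i := i) S T)) //.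
  by rewrite !ffunE qi eqxx.
rewrite big_split /=; congr (_ + _).
rewrite (sum_level (fun p => S (p, dk T x p))) // big_mkcond /=.
apply: eq_bigr => p _; rewrite (bigD1 (dk T x p)) //= ffunE /= eqxx andbT.
rewrite big1 => [|a ap]; last by rewrite ffunE /= eq_sym (negbTE ap) andbF scale0r.
by rewrite addr0; case: ifP; rewrite ?scale1r ?scale0r.
Qed.

Lemma F2_opp (W : lmodType 'F_2) (v : W) : - v = v.
Proof.
apply/eqP; rewrite -subr_eq0 -opprD oppr_eq0 -mulr2n -scaler_nat.
by rewrite (_ : 2%:R = 0) ?scale0r //; apply/eqP; rewrite -(dvdn_pcharf (pchar_Fp _)).
Qed.

(* Shifting the level-[i] tables by the dual family moves the level-[i]
   differences along [E] to any prescribed value without changing [ind] or [P]. *)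
Lemma card_sat (P : pred U) i E : (i <= d)%N ->
  (forall T T', agree i T T' -> P T = P T') ->
  (#|[set T | [&& P T, ind T i E & sat T i E]]| * #|{: Sg}| ^ size E
    <= #|[set T | P T]|)%N.
Proof.
move=> id Pi; set Y := [set T | _].
have -> : (#|{: Sg}| ^ size E = #|[set: {ffun 'I_(size E) -> Sg}]|)%N.
  by rewrite cardsT card_ffun card_ord.
rewrite -cardsX.
pose g (Tu : U * {ffun 'I_(size E) -> Sg}) : U :=
  Tu.1 + shift i (dual (fam Tu.1 i E) Tu.2).
have g_in : {in setX Y setT &, injective g}.
  move=> [T u] [T' u'] /=; rewrite !inE !andbT /= => /and3P[_ iE sE] /and3P[_ iE' sE'].
  rewrite /g /= => gg.
  have TT' : agree i T T'.
    move=> q qi; rewrite -(agree_shift (dual (fam T i E) u) T qi) gg.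
    exact: agree_shift.
  have ff : fam T' i E = fam T i E.
    by apply/ffunP => j; rewrite !ffunE (agree_V TT').
  (* As [sat] makes the old differences vanish, the new ones are exactly [w]; hence [u] can be read
     off from the image of [g]. *)
  have diff (S : U) w : ind S i E -> sat S i E -> forall j,
    let e := tnth (in_tuple E) j in
    let S' := S + shift i (dual (fam S i E) w) in
    dk S' e.1 (c.-1 + i) + dk S' e.2 (c.-1 + i) = w j.
    move=> iS sS j /=; rewrite !dk_shift // addrACA.
    have /allP/(_ _ (mem_tnth j (in_tuple E)))/eqP -> := sS.
    rewrite -[X in X + _ + _]F2_opp addNr add0r -big_split /=.
    rewrite -[RHS](dualE w (fam_free iS)); apply: eq_bigr => ps _.
    by rewrite -scalerDl !ffunE /V /flat /= !big_cons big_nil addr0 !ffunE.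
  have uu : u = u'.
    apply/ffunP => j; rewrite -(diff T u iE sE j) -(diff T' u' iE' sE' j).
    by rewrite gg.
  by move: gg; rewrite uu ff => /addIr ->.
rewrite -(card_in_imset g_in); apply/subset_leq_card/subsetP => T0 /imsetP[[T u]].
rewrite !inE andbT /= => /and3P[PT _ _] ->.
by rewrite (Pi _ T) //; apply: agree_shift.
Qed.

End Levels.

Lemma F2_natr n : (n%:R == 0 :> 'F_2) = ~~ odd n.
Proof. by rewrite -(dvdn_pcharf (pchar_Fp _)) // dvdn2. Qed.

(** Grouped by the value of [f], each summand occurs an even number of times and cancels over
    F_2. *)
Lemma even_fibres_sum0 (A : Type) (B : finType) (W : lmodType 'F_2) (f : A -> B)
    (phi : B -> W) (s : seq A) :
  (forall b, ~~ odd (count (fun x => f x == b) s)) -> \sum_(x <- s) phi (f x) = 0.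
Proof.
move=> ev; transitivity (\sum_b (count (fun x => f x == b) s)%:R *: phi b).
  elim: s {ev} => [|x s IHs]; first by rewrite big_nil big1 // => b _; rewrite scale0r.
  rewrite big_cons IHs /=; under [RHS]eq_bigr => b _ do rewrite natrD scalerDl.
  rewrite big_split /=; congr (_ + _); rewrite (bigD1 (f x)) //= eqxx scale1r.
  by rewrite big1 ?addr0 // => b bx; rewrite eq_sym (negbTE bx) scale0r.
by rewrite big1 // => b _; have := ev b; rewrite -F2_natr => /eqP->; rewrite scale0r.
Qed.

(** * Zero sets *)

Section ZeroSets.
Variables (k c d : nat).
Hypothesis c_gt0 : (0 < c)%N.
Notation Sg := (Sigma k).
Notation K := (Key k c).
Notation U := (DTables k c d).
Implicit Types (T : U) (x y : K) (E : seq (K * K)) (s : seq K).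

Lemma V_coord T i s (p : 'I_(c + d)) (a : Sg) : (p + 1 < c + i)%N ->
  V T i s (p, a) = (count (fun x => dk T x p == a) s)%:R.
Proof.
move=> pc; elim: s => [|x s IHs]; first by rewrite V_nil ffunE.
by rewrite V_cons ffunE IHs ffunE /= pc natrD.
Qed.

Lemma V0P T i s :
  reflect (forall p a, (p < c + d)%N -> (p + 1 < c + i)%N ->
             ~~ odd (count (fun x => dk T x p == a) s)) (V T i s == 0).
Proof.
apply: (iffP eqP) => [V0 p a pcd pc|ev].
  by rewrite -F2_natr -(@V_coord T i s (Ordinal pcd)) // V0 ffunE.
apply/ffunP => -[p a]; rewrite [RHS]ffunE.
have [pc|pc] := ltnP (p + 1)%N (c + i)%N.
  by rewrite V_coord //; apply/eqP; rewrite F2_natr ev.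
rewrite /V sum_ffunE big1 // => x _.
by rewrite ffunE /= ltnNge pc.
Qed.

Lemma V0_le T i j s : (i <= j)%N -> V T j s == 0 -> V T i s == 0.
Proof.
move=> ij /V0P ev; apply/V0P => p a pcd pc; apply: ev => //.
by rewrite (leq_trans pc) ?leq_add2l.
Qed.

Lemma sat_even T i E a : sat T i E ->
  ~~ odd (count (fun x => dk T x (c.-1 + i) == a) (flat E)).
Proof.
elim: E => //= e E IHE /andP[/eqP ee /IHE]; rewrite /flat /= ee.
by rewrite !oddD addbA addbb.
Qed.

(** The only position to check beyond those below level [i] is [c.-1 + i], where the pairs agree. *)
Lemma sat_V0S T i E : (i <= d)%N ->
  V T i (flat E) == 0 -> sat T i E -> V T i.+1 (flat E) == 0.
Proof.
move=> id /V0P ev sE; apply/V0P => p a pcd pc.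
have [pc'|pc'] := ltnP (p + 1)%N (c + i)%N; first exact: ev.
by have -> : p = (c.-1 + i)%N by [lia]; apply: sat_even.
Qed.

(** Parity: the pairs of [E] use every level-[i] character evenly, so the character of [x] must
    occur again in [R]. *)
Lemma partner T i E x (R : seq K) : (i <= d)%N -> sat T i E ->
  V T i.+1 (flat E ++ x :: R) == 0 ->
  exists2 y, y \in R & dk T x (c.-1 + i) == dk T y (c.-1 + i).
Proof.
move=> id sE /V0P/(_ (c.-1 + i)%N (dk T x (c.-1 + i))).
have -> : (c.-1 + i < c + d)%N by lia.
have -> : (c.-1 + i + 1 < c + i.+1)%N by lia.
move=> /(_ isT isT); rewrite count_cat oddD (negbTE (sat_even _ sE)) /= eqxx.
rewrite oddD /= negbK => /odd_gt0; rewrite -has_count => /hasP[y yR xy].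
by exists y => //; rewrite eq_sym.
Qed.

(** The characters before the last are copied into the derived key. The last one is masked by
    level-0 table entries at those characters, which cancel because every position character occurs
    evenly. *)
Lemma V0_sum0 T s : (0 < c + d)%N -> V T 1 s == 0 -> \sum_(x <- s) x = 0.
Proof.
move=> cd /V0P ev.
have sum0 (p : nat) (phi : Sg -> Sg) : (p < c)%N ->
    \sum_(x <- s) phi (dk T x p) = 0.
  move=> pc; apply: (even_fibres_sum0 (f := fun x => dk T x p)) => a.
  by apply: ev; lia.
apply/ffunP => j; rewrite sum_ffunE ffunE.
have [jc|jc] := ltnP j c.-1.
  rewrite -[RHS](sum0 j id) //; apply: eq_bigr => x _.
  by rewrite dk_lt // xchE.
have jE : nat_of_ord j = c.-1 by have := ltn_ord j; lia.
have := sum0 c.-1 id; rewrite prednK // leqnn => /(_ isT).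
under eq_bigr => x _ do rewrite -[c.-1]addn0 dk_level // /= -jE xchE.
rewrite big_split /= exchange_big /= [X in _ + X]big1 ?addr0 // => q /eqP q0.
have : ((val q).2 + 1 < c + (val q).1)%N by case: q {q0}.
rewrite q0 addn0 => q2; apply: sum0.
exact: leq_ltn_trans (leq_addr 1 _) q2.
Qed.

(** Consequently a zero set of distinct keys never consists of a single pair. *)
Lemma no_pair T x y : (0 < c + d)%N -> V T 1 [:: x; y] == 0 -> x = y.
Proof.
move=> cd /(V0_sum0 cd); rewrite !big_cons big_nil addr0 => /eqP.
rewrite addr_eq0 => /eqP->; apply/ffunP => j; rewrite ffunE; exact: F2_opp.
Qed.

End ZeroSets.

(** * Matching the keys of a zero set at one level *)

Section Explore.
Variables (R : realFieldType) (G : nat -> R).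

(** Total potential of the zero sets that a new pair can close with a nonempty subset of [i] matched
    pairs. *)
Definition Ssum i : R := \sum_(m <- masks i | has id m) G (1 + count id m).

(** With [i] pairs matched and [2r] keys left, the head key has [2r - 1] possible partners. The new
    pair either closes a zero set, at price [s ^- i] for the matched pairs, or becomes the next
    independent pair. Nothing remains at [r = 0], since independent pairs form no zero set. *)
Fixpoint fbound (s : R) i r : R :=
  if r is r'.+1 then (r'.*2.+1)%:R * (s ^- i * Ssum i + fbound s i.+1 r') else 0.

Variables (k c d : nat).
Hypothesis c_gt0 : (0 < c)%N.
Notation Sg := (Sigma k).
Notation K := (Key k c).
Notation U := (DTables k c d).
Implicit Types (T : U) (x y : K) (E : seq (K * K)).
Let s : R := #|{: Sg}|%:R.

Let s_gt0 : 0 < s.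
Proof. by rewrite ltr0n; apply/card_gt0P; exists 0. Qed.

Lemma card_satR (P : pred U) i E (q : R) : (i <= d)%N ->
  (forall T T', agree i T T' -> P T = P T') ->
  #|[set T | P T]|%:R <= q ->
  #|[set T | [&& P T, ind T i E & sat T i E]]|%:R <= s ^- size E * q.
Proof.
move=> id Pi Pq; rewrite ler_pdivlMl ?exprn_gt0 //.
apply: le_trans Pq; rewrite mulrC -natrX -natrM ler_nat; exact: card_sat.
Qed.

(** The bound below level [j] is a section hypothesis, supplied by the induction in
    [zero_set_bound]; there [p] is [(3/s)^j] times the number of tables. *)
Variables (j : nat) (p : R).
Hypothesis jd : (j <= d)%N.
Hypothesis IHj : forall (B : seq K) b, uniq B -> size B = b.*2 -> (1 < b)%N ->
  (b.*2.*2 <= #|{: Sg}|)%N -> #|[set T : U | V T j B == 0]|%:R <= G b * p.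

Let perm_pair (x y : K) (F L : seq K) : y \in L ->
  perm_eq (F ++ x :: L) (x :: y :: F ++ rem y L).
Proof.
move=> yL; rewrite -[x :: L]cat1s perm_catCA cat1s perm_cons.
apply: perm_trans (perm_cat (perm_refl F) (perm_to_rem yL)) _.
by rewrite -[y :: rem y L]cat1s perm_catCA.
Qed.

(* [E] holds the pairs matched so far.  The head of [L] has a partner at level [j];
   the new pair is either independent of [E], or it closes a zero set below level
   [j] made of pairs of [E]. *)
Lemma explore r E (L : seq K) :
  uniq (flat E ++ L) -> size L = r.*2 -> (0 < size E + r)%N ->
  ((size E + r).*2.*2 <= #|{: Sg}|)%N ->
  #|[set T : U | [&& V T j.+1 (flat E ++ L) == 0, ind T j E & sat T j E]]|%:R
    <= p * fbound s (size E) r.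
Proof.
elim: r E L => [|r IHr] E L uER sR Er lim.
  (* With no key left, all of [E] would be a zero set below level [j], against its independence. *)
  move/size0nil: sR uER Er => ->; rewrite cats0 addn0 mulr0 => uE E0.
  rewrite (_ : [set T | _] = set0) ?cards0 //; apply/setP => T; rewrite !inE.
  apply/negP => /and3P[/(V0_le (leqnSn j))/eqP V0 iE _].
  have := ind_mask iE (size_nseq (size E) true).
  rewrite mask_true // => /(_ V0)/negP[].
  by case: E E0 {uE lim V0 iE} => // e E _.
case: L sR uER => [|x L] //= [sR] uER.
(* [None] stands for an independent new pair, [Some m] for one that depends on the pairs selected by
   [m]. *)
pose idx := [seq (y, None) | y <- L] ++
  [seq (y, Some m) | y <- L, m <- [seq m <- masks (size E) | has id m]].
pose Q (ym : K * option bitseq) : pred U := fun T => let: (y, om) := ym in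
  if om is Some m then
    [&& V T j (flat ((x, y) :: mask m E)) == 0, ind T j E & sat T j E]
  else [&& V T j.+1 (flat ((x, y) :: E) ++ rem y L) == 0,
           ind T j ((x, y) :: E) & sat T j ((x, y) :: E)].
have cover (T : U) : [&& V T j.+1 (flat E ++ x :: L) == 0, ind T j E & sat T j E] ->
    has (fun i => Q i T) idx.
  move=> /and3P[V0 iE sE]; have [y yR xy] := partner c_gt0 jd sE V0.
  rewrite has_cat; have [iyE|niyE] := boolP (ind T j ((x, y) :: E)).
    apply/orP; left; apply/hasP; exists (y, None); first by apply/mapP; exists y.
    have sxE : sat T j ((x, y) :: E) by rewrite /sat /= xy; exact: sE.
    by rewrite /Q iyE sxE !andbT -(V_perm T j.+1 (perm_pair x (flat E) yR)).
  apply/orP; right; move: niyE; rewrite /= iE andbT => /allPn[m mE].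
  (* With an empty selection [x] and [y] alone would form a zero set, excluded by [no_pair]. *)
  rewrite negbK => Vm; have hm : has id m.
    apply/negPn/negP => hm; have mE0 : mask m E = [::].
      apply/size0nil; rewrite size_mask; last by apply/eqP; rewrite -mem_masks.
      by apply/eqP; rewrite -leqn0 leqNgt -has_count.
    rewrite mE0 in Vm; have sxy : sat T j [:: (x, y)] by rewrite /sat /= xy.
    have := sat_V0S c_gt0 jd Vm sxy => /(V0_le (ltn0Sn j)) /(no_pair c_gt0 (T := T)).
    rewrite ltn_addr // => /(_ isT) /= xyE.
    by move: uER; rewrite cat_uniq /= xyE yR !andbF.
  apply/hasP; exists (y, Some m); last by rewrite /Q Vm iE sE.
  apply/allpairsP; exists (y, m); split=> //=.
  by rewrite mem_filter hm.
have := union_bound cover; rewrite -(ler_nat R) => /le_trans; apply.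
rewrite big_cat big_map big_allpairs_dep natrD !natr_sum /=.
have sizeR : size L = r.*2.+1 by rewrite sR.
rewrite -big_split /=.
have bnd y : y \in L ->
  #|[set T | Q (y, None) T]|%:R +
  (\sum_(m <- [seq m <- masks (size E) | has id m]) #|[set T | Q (y, Some m) T]|)%:R
   <= p * (s ^- size E * Ssum (size E) + fbound s (size E).+1 r).
  move=> yR; rewrite addrC mulrDr; apply: lerD; last first.
    apply: IHr; rewrite ?size_rem ?sizeR //=; last by move: lim; rewrite addnS.
    by move: uER; rewrite (perm_uniq (perm_pair x (flat E) yR)).
  rewrite big_filter natr_sum mulrCA mulrA mulr_sumr big_seq_cond [leRHS]big_seq_cond.
  apply: ler_sum => m /andP[]; rewrite mem_masks => /eqP sm hm.
  rewrite -mulrA [p * _]mulrC; apply: card_satR => // [T T' TT'|].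
    by rewrite (agree_V c_gt0 TT').
  apply: IHj.
  - apply: subseq_uniq (_ : subseq _ (x :: y :: flat E)) _.
      by rewrite /flat /= !eqxx flat_mask_subseq.
    have : uniq (x :: y :: flat E ++ rem y L).
      by rewrite -(perm_uniq (perm_pair x (flat E) yR)).
    by rewrite -[[:: x, y & _]]/((x :: y :: flat E) ++ rem y L) cat_uniq => /andP[].
  - by rewrite size_flat /= size_mask.
  - by rewrite add1n ltnS -has_count.
  apply: leq_trans lim; rewrite !leq_double addnS add1n ltnS.
  by rewrite (leq_trans (count_size _ _)) // sm leq_addr.
apply: le_trans (_ : \sum_(y <- L) p * (s ^- size E * Ssum (size E) +
    fbound s (size E).+1 r) <= _).
  rewrite big_seq_cond [leRHS]big_seq_cond.
  by apply: ler_sum => y /andP[yR _]; apply: bnd.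
by rewrite big_const_seq count_predT sizeR iter_addr addr0 /= mulrCA mulr_natl.
Qed.

End Explore.

(** * The potential of a zero set *)

Section Potential.
Variable R : realFieldType.

(* The growth rate 5/3 and the constant 23/4 make [fbound_le] true (with equality
   at [b = 2]) while keeping the sum [cost_sum] over all walks below 63. *)
Definition G (b : nat) : R := if b == 2%N then 1 else 23 / 4 * (5 / 3) ^+ (b - 2).

Lemma G_le b : (1 < b)%N -> G b <= 23 / 4 * (5 / 3) ^+ (b - 2).
Proof. by rewrite /G; case: eqP => [-> _|//]; rewrite expr0 mulr1; lra. Qed.

Lemma G_ge1 b : (1 < b)%N -> 1 <= G b.
Proof.
rewrite /G; case: eqP => // b2 b1.
have : 1 <= (5 / 3 : R) ^+ (b - 2) by rewrite exprn_ege1 //; lra.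
by lra.
Qed.

Lemma prod_mask (a : R) (m : bitseq) :
  \prod_(b <- m) (if b then a else 1) = a ^+ count id m.
Proof.
elim: m => [|b m IHm]; first by rewrite big_nil.
by rewrite big_cons IHm /=; case: b; rewrite ?mul1r // exprS.
Qed.

Lemma sum_masks (a : R) n : \sum_(m <- masks n) a ^+ count id m = (a + 1) ^+ n.
Proof.
under eq_bigr => m _ do rewrite -prod_mask.
by rewrite sum_lists !big_cons big_nil addr0.
Qed.

Lemma big_masksS (F : bitseq -> R) n : \sum_(m <- masks n.+1) F m =
  \sum_(m <- masks n) F (true :: m) + \sum_(m <- masks n) F (false :: m).
Proof. by rewrite /masks /= cats0 big_cat !big_map. Qed.

Lemma sum_masks0 n : \sum_(m <- masks n) (count id m == 0%N)%:R = 1 :> R.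
Proof.
elim: n => [|n IHn]; first by rewrite /masks /= big_seq1.
by rewrite big_masksS /= big1 ?add0r.
Qed.

Lemma sum_masks1 n : \sum_(m <- masks n) (count id m == 1%N)%:R = n%:R :> R.
Proof.
elim: n => [|n IHn]; first by rewrite /masks /= big_seq1.
rewrite big_masksS /= IHn -natr1 addrC; congr (_ + _); rewrite -[RHS](sum_masks0 n).
by apply: eq_bigr => m _; rewrite add1n eqSS.
Qed.

(** Closed form of [Ssum G i]: the binomial sum [(8/3)^i] without the masks of weight 0 and 1, after
    which the [i] masks of weight 1 return with [G 2 = 1]. Here [69/20 = 23/4 * 3/5]. *)
Definition Sc (i : nat) : R := 69 / 20 * ((8 / 3) ^+ i - 1 - 5 / 3 * i%:R) + i%:R.

Lemma SsumE i : Ssum G i = Sc i.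
Proof.
transitivity (\sum_(m <- masks i) ((69 / 20 : R) * (5 / 3) ^+ count id m
   - 69 / 20 * (count id m == 0%N)%:R - 19 / 4 * (count id m == 1%N)%:R)).
  rewrite /Ssum big_mkcond; apply: eq_bigr => m _; rewrite has_count.
  case: (count id m) => [|[|n]] /=; rewrite /G /=; [by lra|by lra|].
  by rewrite add1n subSS subn1 /= !exprS; lra.
rewrite !sumrB -!mulr_sumr sum_masks sum_masks0 sum_masks1 /Sc.
have -> : 5 / 3 + 1 = 8 / 3 :> R by lra.
by lra.
Qed.

(** [fbound] without its factor [s ^- i]; what is left does not increase with [s], so a check at
    [s = 256] suffices for each small [r]. *)
Fixpoint phi (s : R) i r : R :=
  if r is r'.+1 then (r'.*2.+1)%:R * (Sc i + phi s i.+1 r' / s) else 0.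

Lemma fboundE s i r : fbound G s i r = s ^- i * phi s i r.
Proof.
elim: r i => [|r IHr] i /=; first by rewrite mulr0.
rewrite IHr SsumE exprS invfM [RHS]mulrCA; congr (_ * _); rewrite [RHS]mulrDr; congr (_ + _).
by rewrite [phi _ _ _ / s]mulrC mulrA [_^-1 / _]mulrC.
Qed.

Lemma Sc_ge0 i : 0 <= Sc i.
Proof.
rewrite -SsumE; apply: sumr_ge0 => m hm.
have G1 : (1 < 1 + count id m)%N by rewrite add1n ltnS -has_count.
exact: le_trans (G_ge1 G1).
Qed.

Lemma Sc_le i : Sc i <= 69 / 20 * (8 / 3) ^+ i.
Proof. by have := ler0n R i; rewrite /Sc; lra. Qed.

Lemma phi_ge0 s i r : 0 <= s -> 0 <= phi s i r.
Proof.
move=> s0; elim: r i => [|r IHr] i //=.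
by rewrite mulr_ge0 // addr_ge0 ?Sc_ge0 // divr_ge0.
Qed.

Lemma phi_mono s t i r : 0 < s -> s <= t -> phi t i r <= phi s i r.
Proof.
move=> s0 st; elim: r i => [|r IHr] i //=.
rewrite ler_wpM2l // lerD2l ler_pM ?phi_ge0 ?invr_ge0 //; try by lra.
by rewrite lef_pV2 ?posrE //; lra.
Qed.

(** Since [4r <= s], each round costs a factor at most 1/2, while [(8/3)^i] gains 8/3; hence the
    growth rate 4/3. The new summand fits because [2r + 1 <= 8 * (4/3)^r]. *)
Lemma phi_le s i r : (4 * r)%:R <= s ->
  phi s i r <= 69 / 20 * (8 / 3) ^+ i * (6 * r%:R * (4 / 3) ^+ r).
Proof.
elim: r i => [|r IHr] i; first by rewrite /= !mulr0 mul0r mulr0.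
rewrite mulnS natrD => rs; have {}IHr := IHr i.+1 _.
have r0 := ler0n R r; have r0' := ler0n R (4 * r).
have r4 : (4 * r)%:R = 4 * r%:R :> R by rewrite natrM.
have {}IHr : phi s i.+1 r <= _ := IHr ltac:(lra).
have s0 : 0 < s by lra.
have r21 : (r.*2.+1)%:R = 2 * r%:R + 1 :> R by rewrite -addn1 natrD -muln2 natrM mulrC.
set A := (8 / 3 : R) ^+ i; set B := (4 / 3 : R) ^+ r.
have A0 : 0 < A by rewrite exprn_gt0 //; lra.
have B1 : 1 + r%:R / 3 <= B.
  rewrite /B; elim: (r) => [|n IHn]; first by rewrite expr0 mul0r addr0.
  by rewrite exprS -natr1; have := ler0n R n; nra.
have -> : phi s i r.+1 = (2 * r%:R + 1) * Sc i + (2 * r%:R + 1) / s * phi s i.+1 r.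
  by rewrite /= r21; field; lra.
have half : (2 * r%:R + 1) / s <= 1 / 2 by rewrite ler_pdivrMr //; lra.
have h1 := Sc_le i; rewrite -/A in h1.
have h2 : (2 * r%:R + 1) * Sc i <= (2 * r%:R + 1) * (69 / 20 * A).
  by rewrite ler_wpM2l //; lra.
have h3 : (2 * r%:R + 1) / s * phi s i.+1 r <= 1 / 2 * phi s i.+1 r.
  by rewrite ler_wpM2r // phi_ge0 //; lra.
rewrite exprS -/A -/B in IHr; rewrite exprS -/B -[r.+1%:R]natr1.
have h4 : A * (2 * r%:R + 1) <= A * (8 * B) by rewrite ler_wpM2l //; lra.
move: h4 IHr; set AB := A * (8 * B).
have -> : 69 / 20 * (8 / 3 * A) * (6 * r%:R * B) = 69 / 20 * (2 * r%:R * AB).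
  by rewrite /AB; field.
have -> : 69 / 20 * A * (6 * (r%:R + 1) * (4 / 3 * B)) = 69 / 20 * ((r%:R + 1) * AB).
  by rewrite /AB; field.
by lra.
Qed.

End Potential.

(** * Numerical inequalities for the potential *)

Section Numeric.
Variable R : realFieldType.

Local Notation nZ := Z.of_nat.

(* [20 * 3 ^ i * Sc i] and [20 * 3 ^ (i + r) * 256 ^ r * phi 256 i r] as binary
   integers. *)
Definition ScZ (i : nat) : Z :=
  Z.sub (nZ 69 * (nZ 8 ^ nZ i - nZ 3 ^ nZ i)) (nZ 95 * nZ i * nZ 3 ^ nZ i).

Fixpoint phiZ (i r : nat) : Z := if r is r'.+1 then
  Z.mul (nZ 2 * nZ r' + nZ 1) ((nZ 3 * nZ 256) ^ nZ r * ScZ i + phiZ i.+1 r') else nZ 0.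

Definition Zin (z : Z) : R := (int_of_Z z)%:~R.

Lemma Zin_nat n : Zin (nZ n) = n%:R.
Proof. by rewrite /Zin (_ : int_of_Z _ = n%:Z) ?pmulrn //; case: n => //= n; lia. Qed.
Lemma ZinD x y : Zin (Z.add x y) = Zin x + Zin y.
Proof. by rewrite /Zin -intrD -rmorphD. Qed.
Lemma ZinB x y : Zin (Z.sub x y) = Zin x - Zin y.
Proof. by rewrite /Zin -intrB -rmorphB. Qed.
Lemma ZinM x y : Zin (Z.mul x y) = Zin x * Zin y.
Proof. by rewrite /Zin -intrM -rmorphM. Qed.
Lemma ZinX x n : Zin (Z.pow x (nZ n)) = Zin x ^+ n.
Proof.
elim: n => [|n IHn]; first by rewrite expr0.
by rewrite Nat2Z.inj_succ Z.pow_succ_r ?ZinM ?IHn ?exprS //; apply: Nat2Z.is_nonneg.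
Qed.
Lemma Zin_le x y : Z.leb x y -> Zin x <= Zin y.
Proof. by move=> xy; rewrite /Zin ler_int; lia. Qed.

Definition ZinE := (ZinD, ZinB, ZinM, ZinX, Zin_nat).

Lemma ScZE i : Zin (ScZ i) = 20 * 3 ^+ i * Sc R i.
Proof.
rewrite /ScZ /Sc !ZinE.
have -> : (8 : R) ^+ i = (8 / 3) ^+ i * 3 ^+ i.
  by rewrite -exprMn; congr (_ ^+ _); lra.
by set a := (8 / 3) ^+ i; set b := 3 ^+ i; field.
Qed.

Lemma phiZE i r : Zin (phiZ i r) = 20 * 3 ^+ (i + r) * 256 ^+ r * phi (256 : R) i r.
Proof.
elim: r i => [|r IHr] i; first by rewrite mulr0 -[phiZ _ _]/(nZ 0) Zin_nat.
rewrite -[phiZ i r.+1]/(Z.mul (nZ 2 * nZ r + nZ 1)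
  ((nZ 3 * nZ 256) ^ nZ r.+1 * ScZ i + phiZ i.+1 r)).
rewrite ZinM [Zin (Z.add _ (phiZ _ _))]ZinD [Zin (Z.mul _ (ScZ i))]ZinM ScZE IHr.
rewrite !ZinE /= exprMn addSn -addnS !exprD !exprS.
have -> : (r.*2.+1)%:R = 2 * r%:R + 1 :> R by rewrite -addn1 natrD -muln2 natrM mulrC.
by set a := 3 ^+ i; set b := 3 ^+ r; set e := 256 ^+ r; field.
Qed.

Lemma phi_small r : (0 < r < 46)%N ->
  (2 * r%:R + 3) * (2 * r%:R + 1) * (1 + phi (256 : R) 2 r / 256) <= 69 / 4 * (5 / 3) ^+ r.
Proof.
move=> r_rng.
(* Both sides are multiplied by [180 * 256 * 3^r * 256^r], with [180 = 20 * 3^2] from [phiZE] and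
   [3105 = 180 * 69/4]. *)
pose chk r := Z.leb (Z.mul (Z.mul (nZ 2 * nZ r + nZ 3) (nZ 2 * nZ r + nZ 1))
   (nZ 180 * (nZ 3 ^ nZ r) * (nZ 256 * nZ 256 ^ nZ r) + phiZ 2 r))
  (nZ 3105 * (nZ 5 ^ nZ r) * (nZ 256 * nZ 256 ^ nZ r)).
have : all chk (iota 1 45) by vm_cast_no_check (erefl true).
move=> /allP/(_ r); rewrite mem_iota => /(_ r_rng) /Zin_le.
rewrite ZinM [Zin (Z.add _ (phiZ _ _))]ZinD phiZE !ZinE addSn add1n !exprS.
have -> : (5 : R) ^+ r = (5 / 3) ^+ r * 3 ^+ r.
  by rewrite -exprMn; congr (_ ^+ _); lra.
have a0 : 0 < (3 : R) ^+ r by rewrite exprn_gt0 //; lra.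
have b0 : 0 < (256 : R) ^+ r by rewrite exprn_gt0 //; lra.
set a := 3 ^+ r in a0 *; set b := 256 ^+ r in b0 *; set f := (5 / 3) ^+ r.
set p := phi _ _ _; set n := r%:R => h.
have ab0 : 0 < 180 * 256 * a * b by rewrite !mulr_gt0 //; lra.
rewrite -(ler_pM2l ab0); by move: h; congr (_ <= _); field.
Qed.

(** The factor [184/5 = 69/20 * (8/3)^2 * 6/4] is [phi_le] at [i = 2] combined with
    [r / s <= 1/4]. *)
Lemma phi_large r : (45 < r)%N ->
  (2 * r%:R + 3) * (2 * r%:R + 1) * (1 + 184 / 5 * (4 / 3) ^+ r) <= 69 / 4 * (5 / 3) ^+ r :> R.
Proof.
move=> r46.
(* The slack [37 - 184/5 = 1/5] absorbs the summand 1 once [(4/3)^r >= 5]. *)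
suff : (2 * r%:R + 3) * (2 * r%:R + 1) * (37 * (4 / 3) ^+ r) <= 69 / 4 * (5 / 3) ^+ r :> R
    /\ 5 <= (4 / 3) ^+ r :> R.
  move=> [h B5]; apply: le_trans h; rewrite ler_wpM2l //; last by lra.
  by rewrite mulr_ge0 //; have := ler0n R r; lra.
elim: r r46 => // r IHr; rewrite ltnS leq_eqVlt => /orP[/eqP <-|r45].
  have -> : (4 / 3) ^+ 46 = (4 : R) ^+ 46 / 3 ^+ 46 by rewrite expr_div_n.
  have -> : (5 / 3) ^+ 46 = (5 : R) ^+ 46 / 3 ^+ 46 by rewrite expr_div_n.
  have a0 : 0 < (3 : R) ^+ 46 by rewrite exprn_gt0 //; lra.
  (* At [r = 46] the linear factors are 95 and 93; [3515 = 95 * 37] and [372 = 4 * 93]. *)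
  have h1 : (3515 * 372) * 4 ^+ 46 <= 69 * 5 ^+ 46 :> R.
    have := @Zin_le (Z.mul (nZ 3515 * nZ 372) (nZ 4 ^ nZ 46)) (nZ 69 * nZ 5 ^ nZ 46).
    by rewrite !ZinE; apply; vm_cast_no_check (erefl true).
  have h2 : 5 * 3 ^+ 46 <= 4 ^+ 46 :> R.
    have := @Zin_le (Z.mul (nZ 5) (nZ 3 ^ nZ 46)) (nZ 4 ^ nZ 46).
    by rewrite !ZinE; apply; vm_cast_no_check (erefl true).
  move: h1 h2 a0; set a := 3 ^+ 46; set b := 4 ^+ 46; set e := 5 ^+ 46 => h1 h2 a0.
  split; last by rewrite ler_pdivlMr.
  by rewrite !mulrA ler_pdivrMr // divfK ?gt_eqF //; lra.
move: (IHr r45) => [h B5].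
have r8 : (8 : R) <= r%:R by rewrite (ler_nat R 8); lia.
rewrite !exprS -[r.+1%:R]natr1.
move: h B5; set B := (4 / 3) ^+ r; set f := (5 / 3) ^+ r; set n := r%:R => h B5.
split; last by lra.
have : (2 * n + 5) * (4 / 3) <= (2 * n + 1) * (5 / 3) by lra.
move=> h3; have B0 : 0 <= (2 * n + 3) * (37 * B) by rewrite mulr_ge0 //; rewrite /n in r8 *; lra.
have := ler_wpM2r B0 h3; move: h.
have -> : (2 * n + 3) * (2 * n + 1) * (37 * B) = (2 * n + 1) * ((2 * n + 3) * (37 * B)).
  by ring.
have -> : (2 * (n + 1) + 3) * (2 * (n + 1) + 1) * (37 * (4 / 3 * B)) =
    (2 * n + 5) * (4 / 3) * ((2 * n + 3) * (37 * B)) by field.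
set Y := (2 * n + 3) * (37 * B) in B0 *.
have -> : (2 * n + 1) * (5 / 3) * Y = 5 / 3 * ((2 * n + 1) * Y) by field.
by lra.
Qed.

(** As [Sc 0 = 0] and [Sc 1 = 1], the first two rounds are written out, leaving [r = b - 2]. The
    case [r = 0] is exact, [r <= 45] reduces to [s = 256] by monotonicity, and larger [r] uses
    [4b <= s]. *)
Lemma fbound_le (s : R) b : 256 <= s -> (1 < b)%N -> (4 * b)%:R <= s ->
  fbound (G R) s 0 b <= 3 / s * G R b.
Proof.
move=> s256 b1 bs; have s0 : 0 < s by lra.
rewrite fboundE expr0 invr1 mul1r.
case: b b1 bs => [//|[//|r]] _; rewrite natrM -[in r.+2%:R]addn2 natrD => bs.
have SE : Sc R 0 = 0 /\ Sc R 1 = 1 by rewrite /Sc expr0 expr1 mulr0n mulr1n; split; lra.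
have d1 : (r.+1.*2.+1)%:R = 2 * r%:R + 3 :> R.
  by rewrite -addn1 natrD -muln2 natrM -natr1 mulrDl mulrC; lra.
have d0 : (r.*2.+1)%:R = 2 * r%:R + 1 :> R by rewrite -addn1 natrD -muln2 natrM mulrC.
have -> : phi s 0 r.+2 = ((2 * r%:R + 3) * (2 * r%:R + 1) * (1 + phi s 2 r / s)) / s.
  by rewrite [LHS]/= d1 d0 SE.1 SE.2; field; lra.
rewrite [3 / s * _]mulrAC ler_wpM2r ?invr_ge0 ?(ltW s0) //.
have r0 := ler0n R r.
case: r => [|r] in bs d1 d0 r0 *.
  by rewrite -[G R 2]/(1 : R) -[phi s 2 0]/(0 : R) mul0r mulr0n; lra.
have -> : G R r.+3 = 23 / 4 * (5 / 3) ^+ r.+1 by rewrite /G subSS subSS subn0.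
apply: le_trans (_ : 69 / 4 * (5 / 3) ^+ r.+1 <= _); last by lra.
have n0 : 0 <= (2 * r.+1%:R + 3) * (2 * r.+1%:R + 1) :> R by rewrite mulr_ge0 //; lra.
have [rs|rl] := ltnP r.+1 46%N.
  apply: le_trans (phi_small (r := r.+1) _); last by rewrite rs.
  rewrite ler_wpM2l // lerD2l ler_pM ?invr_ge0 ?phi_ge0 ?phi_mono //; try lra.
  by rewrite lef_pV2 ?posrE //; lra.
apply: le_trans (phi_large rl); rewrite ler_wpM2l // lerD2l.
have /le_trans : phi s 2 r.+1 / s <= 69 / 20 * (8 / 3) ^+ 2 * (6 * r.+1%:R * (4 / 3) ^+ r.+1) / s.
  by rewrite ler_wpM2r ?invr_ge0 ?phi_le //; try lra; rewrite natrM; lra.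
apply; rewrite ler_pdivrMr //; set B := (4 / 3) ^+ r.+1.
have B0 : 0 <= B by rewrite exprn_ge0 //; lra.
have : (4 * r.+1%:R) * B <= s * B by rewrite ler_wpM2r //; lra.
by rewrite expr2; set n := r.+1%:R; nra.
Qed.

(** * Probability that a fixed set of keys is a zero set *)

Section ZeroSetBound.
Variables (k c d : nat).
Hypotheses (k_ge8 : (8 <= k)%N) (c_gt0 : (0 < c)%N).

Lemma card_Sigma : #|{: Sigma k}| = (2 ^ k)%N.
Proof. by rewrite card_mx card_Fp // mul1n. Qed.

Lemma card_Sigma_ge : 256 <= #|{: Sigma k}|%:R :> R.
Proof.
by rewrite (ler_nat R 256) card_Sigma -[256%N]/(2 ^ 8)%N leq_exp2l.
Qed.

(** Induction on the level: [explore] from the empty matching gives the factor [fbound], and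
    [fbound_le] returns the potential [G b] at the price of [3 / s]. *)
Lemma zero_set_bound j (B : seq (Key k c)) b : (j <= d)%N ->
  uniq B -> size B = b.*2 -> (1 < b)%N -> (b.*2.*2 <= #|{: Sigma k}|)%N ->
  #|[set T : DTables k c d | V T j B == 0]|%:R <=
    G R b * ((3 / #|{: Sigma k}|%:R) ^+ j * #|{: DTables k c d}|%:R).
Proof.
have s256 := card_Sigma_ge.
elim: j B b => [|j IHj] B b jd uB sB b1 lim.
  rewrite expr0 mul1r; apply: le_trans (_ : #|{: DTables k c d}|%:R <= _).
    by rewrite ler_nat max_card.
  by rewrite ler_peMl ?G_ge1 ?ler0n.
have IH B' b' := IHj B' b' (ltnW jd).
have := explore c_gt0 (ltnW jd) IH (r := b) (E := [::]) (L := B) uB sB (ltnW b1) lim.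
rewrite [size [::]]/=; set s := #|{: Sigma k}|%:R in s256 *; set p := _ ^+ j * _ => h.
apply: le_trans (le_trans _ h) _.
  by rewrite ler_nat; apply/subset_leq_card/subsetP => T; rewrite !inE /= andbT.
have p0 : 0 <= p by rewrite mulr_ge0 ?exprn_ge0 ?divr_ge0 ?ler0n.
have bs : (4 * b)%:R <= s by rewrite ler_nat; move: lim; rewrite -!muln2 -mulnA mulnC.
apply: le_trans (ler_wpM2l p0 (fbound_le s256 b1 bs)) _.
by rewrite le_eqVlt; apply/orP; left; apply/eqP; rewrite exprS /p; ring.
Qed.

End ZeroSetBound.
End Numeric.

(** The head is matched with another element of its fibre and both are removed. Being the identity
    outside the list, the inductive matching can be extended without collision. *)
Lemma even_fibres_matching (A B : eqType) (f : A -> B) (s : seq A) :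
  uniq s -> (forall b, ~~ odd (count (fun x => f x == b) s)) ->
  exists t : A -> A, [/\ involutive t,
    {in s, forall x, [/\ t x \in s, t x != x & f (t x) = f x]}
    & forall x, x \notin s -> t x = x].
Proof.
have [n] := ubnP (size s); elim: n s => // n IHn [|x s] sn.
  by exists id; split.
move=> /= /andP[xs us] ev.
have := ev (f x); rewrite /= eqxx oddD /= negbK => /odd_gt0.
rewrite -has_count => /hasP[y ys /eqP fxy].
have ps := perm_to_rem ys.
have xy : x != y by apply: contraNneq xs => ->.
have yr : y \notin rem y s by rewrite mem_rem_uniq // inE eqxx.
have xr : x \notin rem y s by rewrite mem_rem_uniq // inE (negbTE xs) andbF.
have [||b|t [tK ts tn]] := IHn (rem y s).
- by rewrite size_rem //; move: sn => /=; lia.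
- exact: rem_uniq.
- have := ev b; rewrite /= (permP ps) /= fxy addnA addnn oddD odd_double.
  by [].
have nx z : z != x -> t z != x.
  by move=> zx; apply: contraNneq zx => tz; rewrite -(tK z) tz tn.
have ny z : z != y -> t z != y.
  by move=> zy; apply: contraNneq zy => tz; rewrite -(tK z) tz tn.
exists (fun z => if z == x then y else if z == y then x else t z); split.
- move=> z; have [->|zx] := eqVneq z x; first by rewrite eq_sym (negbTE xy) eqxx.
  have [->|zy] := eqVneq z y; first by rewrite eqxx.
  by rewrite (negbTE (nx _ zx)) (negbTE (ny _ zy)) tK.
- move=> z; rewrite inE; have [-> _|zx /= zs] := eqVneq z x.
    by rewrite inE ys orbT eq_sym.
  have [->|zy] := eqVneq z y; first by rewrite inE eqxx.
  have zr : z \in rem y s by rewrite mem_rem_uniq // inE zy.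
  have [tr tz ft] := ts _ zr; split=> //.
  by rewrite inE (mem_rem tr) orbT.
move=> z; rewrite inE negb_or => /andP[zx zs]; rewrite (negbTE zx).
have [zy|zy] := eqVneq z y; first by rewrite zy ys in zs.
by rewrite tn // mem_rem_uniq // inE negb_and zs orbT.
Qed.

(** * Alternating walks of two matchings *)

Section Walk.
Variables (A : finType) (sg tau : A -> A) (Z : {set A}).
Hypotheses (sgK : involutive sg) (tauK : involutive tau).
Hypotheses (sgZ : {in Z, forall x, sg x \in Z}) (tauZ : {in Z, forall x, tau x \in Z}).
Hypotheses (sgN : {in Z, forall x, sg x != x}) (tauN : {in Z, forall x, tau x != x}).

Definition step x := sg (tau x).

Lemma step_inj : injective step.
Proof. by move=> x y; rewrite /step => /(inv_inj sgK)/(inv_inj tauK). Qed.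

Lemma stepZ : {in Z, forall x, step x \in Z}.
Proof. by move=> x xZ; apply/sgZ/tauZ. Qed.

Lemma iter_stepZ n : {in Z, forall x, iter n step x \in Z}.
Proof. by move=> x xZ; elim: n => //= n; apply: stepZ. Qed.

Lemma tau_step x : step (tau (step x)) = tau x.
Proof. by rewrite /step tauK sgK. Qed.

(** By [tau_step], [tau] reverses [step]: an equality at [n + 2] descends to [n], and at 0 or 1 it
    gives a fixed point of [tau] or [sg]. So an alternating cycle splits into two orbits exchanged
    by [tau]. *)
Lemma tau_notin_orbit n x : x \in Z -> tau x != iter n step x.
Proof.
have [m] := ubnP n; elim: m n x => // m IHm [|[|n]] x nm xZ; first exact: tauN.
  by rewrite eq_sym; apply/sgN/tauZ.
rewrite -tau_step iterS iterSr (inj_eq step_inj).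
by apply: IHm; [lia | exact: stepZ].
Qed.

Definition vs (l : seq A) : seq A := flat [seq (z, tau z) | z <- l].

Lemma vs_cat l1 l2 : vs (l1 ++ l2) = vs l1 ++ vs l2.
Proof. by rewrite /vs map_cat flat_cat. Qed.

Lemma vs_cons z l : vs (z :: l) = [:: z, tau z & vs l]. Proof. by []. Qed.

Lemma size_vs l : size (vs l) = (size l).*2.
Proof. by rewrite size_flat size_map. Qed.

Lemma mem_vs l x : (x \in vs l) = (x \in l) || (tau x \in l).
Proof.
elim: l => //= z l IHl; rewrite /vs /flat /= !inE -/(flat _) -/(vs l) IHl.
by rewrite -(inj_eq (can_inj tauK) x (tau z)) tauK; case: (x == z); case: (x \in l); rewrite ?orbT.
Qed.

Lemma uniq_vs l : {subset l <= Z} -> uniq l ->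
  {in l &, forall x y, tau x != y} -> uniq (vs l).
Proof.
elim: l => //= z l IHl lZ /andP[zl ul] tl; rewrite /vs /flat /= -/(flat _) -/(vs l).
have zZ : z \in Z by rewrite lZ // mem_head.
have zt y : y \in l -> tau z != y.
  by move=> yl; rewrite tl // inE ?yl ?eqxx ?orbT.
have ztl : tau z \notin l by apply/negP => /zt; rewrite eqxx.
rewrite IHl => // [|x xl|x y xl yl]; last first.
- by rewrite tl // inE ?xl ?yl orbT.
- by rewrite lZ // inE xl orbT.
rewrite !inE !mem_vs tauK eq_sym (negbTE (tauN zZ)) /=.
by rewrite (negbTE zl) (negbTE ztl).
Qed.

Definition cycles (r : seq A) := flatten [seq orbit step y | y <- r].

Lemma vs_tau l x : x \in vs l -> tau x \in vs l.
Proof. by rewrite !mem_vs tauK orbC. Qed.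

Lemma vs_cycles_step r x : x \in vs (cycles r) -> step x \in vs (cycles r).
Proof.
have cl z : z \in cycles r -> step z \in cycles r.
  move=> /flatten_mapP[y yr zy]; apply/flatten_mapP; exists y => //.
  by move: zy; rewrite -!fconnect_orbit => /connect_trans; apply; apply: fconnect1.
have clV z w : step w = z -> z \in cycles r -> w \in cycles r.
  move=> wz /flatten_mapP[y yr zy]; apply/flatten_mapP; exists y => //.
  move: zy; rewrite -!fconnect_orbit => /connect_trans; apply.
  by rewrite (fconnect_sym step_inj) -wz fconnect1.
rewrite !mem_vs => /orP[/cl ->//|tx]; apply/orP; right.
by apply: clV tx; apply: tau_step.
Qed.

Lemma vs_cycles_iter r x n : x \in vs (cycles r) -> iter n step x \in vs (cycles r).
Proof. by move=> xr; elim: n => //= n; apply: vs_cycles_step. Qed.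

Lemma cycles_sub r : {subset r <= Z} -> {subset cycles r <= Z}.
Proof.
move=> rZ x /flatten_mapP[y yr]; rewrite -fconnect_orbit => /iter_findex <-.
by apply/iter_stepZ/rZ.
Qed.

Lemma vs_sub l : {subset l <= Z} -> {subset vs l <= Z}.
Proof.
by move=> lZ x; rewrite mem_vs => /orP[/lZ//|/lZ/tauZ]; rewrite tauK.
Qed.

Lemma orbit_tauN z : z \in Z -> {in orbit step z &, forall x y, tau x != y}.
Proof.
move=> zZ x y; rewrite -!fconnect_orbit => zx zy.
have xZ : x \in Z by rewrite -(iter_findex zx) iter_stepZ.
have xy : fconnect step x y.
  by apply: connect_trans zy; rewrite (fconnect_sym step_inj).
by rewrite -(iter_findex xy); apply: tau_notin_orbit.
Qed.

Lemma uniq_vs_orbit z : z \in Z -> uniq (vs (orbit step z)).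
Proof.
move=> zZ; apply: uniq_vs => [x||]; last exact: orbit_tauN.
  by rewrite -fconnect_orbit => /iter_findex <-; apply: iter_stepZ.
exact: orbit_uniq.
Qed.

Lemma vs_orbit_sub x y : x \in vs (orbit step y) -> {subset vs (orbit step x) <= vs (orbit step y)}.
Proof.
have -> : orbit step y = cycles [:: y] by rewrite /cycles /= cats0.
move=> xy w; rewrite [w \in vs (orbit _ _)]mem_vs -!fconnect_orbit.
move=> /orP[] /iter_findex wE; first by rewrite -wE vs_cycles_iter.
by rewrite -[w]tauK vs_tau // -wE vs_cycles_iter.
Qed.

(** Any key of an alternating cycle, on either side of [tau], may serve as its starting point. *)
Lemma vs_orbit_perm x y : y \in Z -> x \in vs (orbit step y) ->
  perm_eq (vs (orbit step x)) (vs (orbit step y)).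
Proof.
move=> yZ xy.
have oZ : {subset orbit step y <= Z}.
  by move=> w; rewrite -fconnect_orbit => /iter_findex <-; apply: iter_stepZ.
have xZ := vs_sub oZ xy.
apply: uniq_perm; rewrite ?uniq_vs_orbit // => w; apply/idP/idP; apply: vs_orbit_sub => //.
have : (x \in orbit step y) || (tau x \in orbit step y) by rewrite -mem_vs.
rewrite -!fconnect_orbit => /orP[yx|].
  have xy' : fconnect step x y by rewrite (fconnect_sym step_inj).
  by rewrite mem_vs -!fconnect_orbit xy'.
have ox : orbit step x = cycles [:: x] by rewrite /cycles /= cats0.
rewrite (fconnect_sym step_inj) => txy; rewrite -(iter_findex txy) ox.
by apply: vs_cycles_iter; rewrite -ox vs_tau // mem_vs -!fconnect_orbit connect0.
Qed.

Lemma cycles_cover : exists r, [/\ {subset r <= Z}, uniq (vs (cycles r))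
  & {subset Z <= vs (cycles r)}].
Proof.
suff H n r : (#|Z :\: [set x in vs (cycles r)]| < n)%N -> {subset r <= Z} ->
    uniq (vs (cycles r)) -> exists r, [/\ {subset r <= Z}, uniq (vs (cycles r))
    & {subset Z <= vs (cycles r)}].
  by apply: (H _ [::]) => //.
elim: n r => // n IHn r rn rZ ur.
have [/subsetP sub|/subsetPn[z zZ]] := boolP (Z \subset [set x in vs (cycles r)]).
  by exists r; split=> // x /sub; rewrite inE.
rewrite inE => zr.
have oZ : {subset orbit step z <= Z}.
  by move=> w; rewrite -fconnect_orbit => /iter_findex <-; apply: iter_stepZ.
have zV : z \in vs (cycles (z :: r)).
  by rewrite mem_vs mem_cat -!fconnect_orbit connect0.
apply: (IHn (z :: r)).
- rewrite ltnS in rn; apply: leq_trans rn; apply: proper_card; apply/properP; split.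
    apply/subsetP => x; rewrite !inE => /andP[xr ->]; rewrite andbT.
    by apply: contraNN xr; rewrite /cycles /= vs_cat mem_cat => ->; rewrite orbT.
  by exists z; rewrite !inE ?zr ?zV.
- by move=> x; rewrite inE => /orP[/eqP->|/rZ].
rewrite /cycles /= vs_cat cat_uniq uniq_vs_orbit // ur andbT /=.
apply/hasPn => x xr; apply/negP => xz.
have [tx|] := boolP (x \in orbit step z).
  rewrite -fconnect_orbit (fconnect_sym step_inj) in tx.
  by move: zr; rewrite -(iter_findex tx) vs_cycles_iter.
move=> nx; move: xz; rewrite mem_vs (negbTE nx) /= => tx.
rewrite -fconnect_orbit (fconnect_sym step_inj) in tx.
by move: zr; rewrite -(iter_findex tx) vs_cycles_iter // vs_tau.
Qed.

Variable Dp : pred {set A}.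

(** Dependence of the tau-pairs of [l], witnessed by a nonempty union of such pairs; [Dp] will say
    that [V] vanishes below level [d]. *)
Definition dep (l : seq A) := [exists S : {set A},
  [&& S != set0, S \subset [set x in vs l], [forall x in S, tau x \in S] & Dp S]].

Lemma dep_sub l1 l2 : {subset vs l1 <= vs l2} -> dep l1 -> dep l2.
Proof.
move=> sub /existsP[S /and4P[S0 Sl St DS]]; apply/existsP; exists S.
rewrite S0 St DS !andbT /=; apply: subset_trans Sl _.
by apply/subsetP => x; rewrite !inE; apply: sub.
Qed.

Variable rk : A -> nat.
Hypothesis rk_inj : injective rk.

Definition state y k r := y :: traject step (step y) k ++ cycles r.

(* A dependent state of least size: [y] and the far end of its path lie in the
   dependent set [S], and so does the canonical starting point of every cycle. *)
Lemma minimal_walk : Z != set0 -> Dp Z -> exists y k r (S : {set A}),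
  [/\ [/\ uniq (vs (state y k r)), {subset state y k r <= Z} & ~~ dep (behead (state y k r))],
      [/\ S \subset [set x in vs (state y k r)], {in S, forall x, tau x \in S} & Dp S],
      y \in S, (0 < k)%N -> iter k step y \in S
    & {in r, forall z, z \in S /\ (rk z < rk (tau z))%N}].
Proof.
move=> Z0 DZ.
suff H n y k r : (size (state y k r) < n)%N -> uniq (vs (state y k r)) ->
    {subset state y k r <= Z} -> dep (state y k r) -> exists y k r (S : {set A}),
  [/\ [/\ uniq (vs (state y k r)), {subset state y k r <= Z} & ~~ dep (behead (state y k r))],
      [/\ S \subset [set x in vs (state y k r)], {in S, forall x, tau x \in S} & Dp S],
      y \in S, (0 < k)%N -> iter k step y \in S
    & {in r, forall z, z \in S /\ (rk z < rk (tau z))%N}].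
  have [r [rZ ur Zr]] := cycles_cover.
  case: r rZ ur Zr => [_ _|y r rZ ur Zr].
    by have /set0Pn[z /[swap] /[apply]] := Z0.
  have st : state y (order step y).-1 r = cycles (y :: r).
    rewrite /cycles /= /orbit -{2}(prednK (order_gt0 step y)) trajectS.
    by rewrite /state /=.
  apply: (H _ y (order step y).-1 r (ltnSn _)); rewrite st //; first exact: cycles_sub.
  apply/existsP; exists Z; rewrite Z0 DZ andbT /=; apply/andP; split.
    by apply/subsetP => x /Zr; rewrite inE.
  by apply/forall_inP.
elim: n y k r => // n IHn y k r sz us sZ dl.
have dep0 : ~~ dep [::].
  apply/negP => /existsP[S /and4P[/set0Pn[x xS] /subsetP/(_ x xS)]].
  by rewrite inE.
(* If the rest is still dependent, the first pair is dropped; when the path has no further pair, the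
   next cycle is cut open and becomes the path. *)
have [dt|nd] := boolP (dep (behead (state y k r))).
  case: k sz us sZ dl dt => [|k] sz us sZ dl dt.
    case: r sz us sZ dl dt => [|z r] sz us sZ dl dt; first by case/negP: dep0.
    have st : state z (order step z).-1 r = cycles (z :: r).
      rewrite /cycles /= /orbit -{2}(prednK (order_gt0 step z)) trajectS.
      by rewrite /state /=.
    apply: (IHn z (order step z).-1 r); rewrite ?st //.
    - by move: us; rewrite /state vs_cons => /and3P[].
    - by move=> x xc; rewrite sZ // inE xc orbT.
  apply: (IHn (step y) k r) => //.
  - by move: us; rewrite /state vs_cons => /and3P[].
  - by move=> x xc; rewrite sZ // inE xc orbT.
have /existsP[S /and4P[S0 Sl St DS]] := dl.
have Stau : {in S, forall x, tau x \in S} by apply/forall_inP.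
have Svs x : x \in S -> x \in vs (state y k r).
  by move=> xS; have /subsetP/(_ x xS) := Sl; rewrite inE.
have yS : y \in S.
  apply/negPn/negP => yS; move/negP: nd; apply; apply/existsP; exists S.
  rewrite S0 St DS !andbT /=; apply/subsetP => x xS.
  have /or3P[/eqP xy|/eqP xy|] : [|| x == y, x == tau y
      | x \in vs (behead (state y k r))] by exact: Svs.
  - by rewrite -xy xS in yS.
  - by move: yS; rewrite -[y]tauK -xy Stau.
  by rewrite inE.
(* Pairs that miss [S] can be deleted, as [S] still witnesses dependence. This trims the far end of
   the path and removes whole cycles. *)
have red y' k' r' l1 l2 l3 : state y k r = l1 ++ l2 ++ l3 -> state y' k' r' = l1 ++ l3 ->
    (0 < size l2)%N -> {in l2, forall x, x \notin S} -> exists y k r (S : {set A}),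
  [/\ [/\ uniq (vs (state y k r)), {subset state y k r <= Z} & ~~ dep (behead (state y k r))],
      [/\ S \subset [set x in vs (state y k r)], {in S, forall x, tau x \in S} & Dp S],
      y \in S, (0 < k)%N -> iter k step y \in S
    & {in r, forall z, z \in S /\ (rk z < rk (tau z))%N}].
  move=> st st' l2_gt0 l2S; apply: (IHn y' k' r'); rewrite st'.
  - by move: sz; rewrite st !size_cat; lia.
  - move: us; rewrite st !vs_cat; apply: subseq_uniq.
    by rewrite cat_subseq // suffix_subseq.
  - move=> x; rewrite mem_cat => /orP[] xl; apply: sZ; rewrite st !mem_cat xl ?orbT //.
  apply/existsP; exists S; rewrite S0 St DS !andbT /=; apply/subsetP => x xS.
  have := Svs x xS; rewrite inE st !vs_cat !mem_cat.
  case/or3P => [->//||->]; rewrite ?orbT //; rewrite mem_vs => /orP[] /l2S; first by rewrite xS.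
  by rewrite Stau.
have [/andP[k0 kS]|kk] := boolP ((0 < k)%N && (iter k step y \notin S)).
  case: k k0 kS sz us sZ dl nd Sl Svs red => // k _ kS sz us sZ dl nd Sl Svs red.
  apply: (red y k r (y :: traject step (step y) k) [:: iter k step (step y)] (cycles r)) => //.
    by rewrite /state trajectSr cat_rcons.
  by move=> x; rewrite inE => /eqP->; rewrite -iterSr.
have [/allP hr|/allPn[z zr]] := boolP (all (fun z => has (mem S) (orbit step z)) r); last first.
  move=> /hasPn zS; case/splitPr: zr red sz us sZ dl nd Sl Svs => r1 r2 red sz us sZ dl nd Sl Svs.
  apply: (red y k (r1 ++ r2) (y :: traject step (step y) k ++ cycles r1)
    (orbit step z) (cycles r2)) => //.
  - by rewrite /state /cycles map_cat flatten_cat /= !catA.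
  - by rewrite /state /cycles map_cat flatten_cat /= !catA.
  by rewrite /orbit size_traject order_gt0.
have rZ : {subset r <= Z}.
  move=> z zr; apply: sZ; rewrite inE mem_cat; apply/orP; right; apply/orP; right.
  by apply/flatten_mapP; exists z; rewrite // -fconnect_orbit connect0.
have [r' [pr rr]] : exists r', perm_eq (vs (cycles r')) (vs (cycles r)) /\
    {in r', forall z, [/\ z \in Z, z \in S & (rk z < rk (tau z))%N]}.
  elim: (r) hr rZ => [|z r1 IHr] hr rZ; first by exists [::].
  have [||r2 [pr2 rr2]] := IHr.
  - by move=> w wr; apply: hr; rewrite inE wr orbT.
  - by move=> w wr; apply: rZ; rewrite inE wr orbT.
  have zZ : z \in Z by apply: rZ; rewrite mem_head.
  have oZ : {subset orbit step z <= Z}.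
    by move=> w; rewrite -fconnect_orbit => /iter_findex <-; apply: iter_stepZ.
  have /hasP[w wz /= wS] := hr z (mem_head _ _).
  have wv : w \in vs (orbit step z) by rewrite mem_vs wz.
  (* As [S] is closed under [tau], the member of lower rank in the pair can start the cycle; this
     halves the choices of starting pairs. *)
  have [w' [wv' wS' wr]] : exists w', [/\ w' \in vs (orbit step z), w' \in S
      & (rk w' < rk (tau w'))%N].
    have : rk w != rk (tau w) by rewrite (inj_eq rk_inj) eq_sym tauN // oZ.
    rewrite neq_ltn => /orP[h|h]; first by exists w.
    by exists (tau w); rewrite tauK vs_tau // Stau.
  exists (w' :: r2); split.
    by rewrite /cycles /= !vs_cat; apply: perm_cat => //; apply: vs_orbit_perm.
  move=> x; rewrite inE => /orP[/eqP->|/rr2//]; split=> //.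
  exact: vs_sub wv'.
have pst : perm_eq (vs (state y k r')) (vs (state y k r)).
  rewrite /state -!cat_cons !vs_cat; exact: perm_cat.
have pst' : perm_eq (vs (behead (state y k r'))) (vs (behead (state y k r))).
  rewrite /state /= !vs_cat; exact: perm_cat.
exists y, k, r', S; split=> //; last by move=> z /rr[].
- split; first by rewrite (perm_uniq pst).
    move=> x; rewrite /state inE mem_cat orbA => /orP[xl|].
      by apply: sZ; rewrite inE mem_cat orbA xl.
    by apply: cycles_sub => z /rr[].
  apply: contraNN nd; apply: dep_sub => x.
  by rewrite (perm_mem pst').
- by split=> //; apply/subsetP => x /Svs xs; rewrite inE (perm_mem pst).
by move=> k0; move: kk; rewrite k0 /= negbK.
Qed.

End Walk.

(** * Encoded walks *)

(* A path is a list of tau-pairs with a flag telling membership in the dependent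
   set; in a list of cycles the flag [None] marks the first pair of a cycle, which
   always belongs to the dependent set.  The edges are the sigma-pairs. *)
Section Edges.
Variable A : eqType.

Fixpoint pedges (prev : A) (l : seq (bool * (A * A))) : seq (A * A) :=
  if l is (_, (x, y)) :: l' then (prev, x) :: pedges y l' else [::].

(** [st] is the start of the current cycle and [prev] the last key reached; a flag [None] closes the
    cycle with the edge to [st] and opens the next one. *)
Fixpoint cedges (st prev : A) (l : seq (option bool * (A * A))) : seq (A * A) :=
  if l is (t, (x, y)) :: l' then
    if t is Some _ then (prev, x) :: cedges st y l' else (prev, st) :: cedges x y l'
  else [:: (prev, st)].

Definition cyc_edges (l : seq (option bool * (A * A))) : seq (A * A) :=
  if l is (_, (x, y)) :: l' then cedges x y l' else [::].

Lemma size_pedges p l : size (pedges p l) = size l.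
Proof. by elim: l p => //= -[b [x y]] l IHl p /=; rewrite IHl. Qed.

Lemma size_cyc_edges l : size (cyc_edges l) = size l.
Proof.
case: l => //= -[b [x y]] l; elim: l x y => //= -[[t|] [x y]] l IHl x' y' /=;
  by rewrite IHl.
Qed.

Lemma flat_cons (e : A * A) E : flat (e :: E) = [:: e.1, e.2 & flat E].
Proof. by []. Qed.

(** [z] is the far end of the path, the one key left without an edge. *)
Lemma perm_pedges p l :
  exists z, perm_eq (z :: flat (pedges p l)) (p :: flat [seq t.2 | t <- l]).
Proof.
elim: l p => [|[b [x y]] l IHl] p /=; first by exists p.
have [z pz] := IHl y; exists z; rewrite !flat_cons /=.
rewrite -[[:: z, p, x & _]]/([:: z] ++ [:: p; x] ++ _) perm_catCA /= !perm_cons.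
exact: pz.
Qed.

Lemma perm_cyc_edges l : perm_eq (flat (cyc_edges l)) (flat [seq t.2 | t <- l]).
Proof.
case: l => // -[b [x y]] l; rewrite /= flat_cons /=.
elim: l x y => [|[[t|] [x y]] l IHl] x' y' /=; rewrite !flat_cons /=.
- by rewrite -[[:: y'; x']]/([:: y'] ++ [:: x']) perm_catC.
- rewrite -[[:: y', x & _]]/([:: y'; x] ++ _).
  apply: perm_trans (perm_cat (perm_refl _) (IHl x' y)) _.
  rewrite -[[:: x', y', x, y & _]]/([:: x'] ++ [:: y'; x] ++ [:: y & flat [seq t0.2 | t0 <- l]]).
  by rewrite perm_sym perm_catCA.
rewrite -[[:: y', x' & _]]/([:: y'] ++ [:: x'] ++ _).
rewrite -[[:: x', y', x, y & _]]/([:: x'] ++ [:: y'] ++ [:: x, y & flat [seq t0.2 | t0 <- l]]).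
by rewrite perm_catCA !perm_cons.
Qed.

End Edges.

Section WalkEdges.
Variables (A : finType) (sg tau : A -> A) (S : {set A}).
Hypotheses (sgK : involutive sg) (tauK : involutive tau).
Notation step := (step sg tau).

Definition pcode y k := [seq (z \in S, (z, tau z)) | z <- traject step (step y) k].

Definition ccode1 y := (None, (y, tau y)) ::
  [seq (Some (z \in S), (z, tau z)) | z <- traject step (step y) (order step y).-1].

Definition ccode r := flatten [seq ccode1 y | y <- r].

Lemma orbit_traject y : orbit step y = y :: traject step (step y) (order step y).-1.
Proof. by rewrite /orbit -{1}(prednK (order_gt0 step y)) trajectS. Qed.

Lemma pcode_pairs y k :
  [seq t.2 | t <- pcode y k] = [seq (z, tau z) | z <- traject step (step y) k].
Proof. by rewrite /pcode -map_comp. Qed.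

Lemma ccode_pairs r : [seq t.2 | t <- ccode r] = [seq (z, tau z) | z <- cycles sg tau r].
Proof.
elim: r => // y r IHr; rewrite -[ccode (y :: r)]/(ccode1 y ++ ccode r).
rewrite -[cycles _ _ (y :: r)]/(orbit step y ++ cycles sg tau r) !map_cat IHr.
by congr (_ ++ _); rewrite orbit_traject /= -map_comp.
Qed.

Lemma pcode_flags y k : [seq t.2 | t <- pcode y k & t.1] =
  [seq (z, tau z) | z <- traject step (step y) k & z \in S].
Proof. by rewrite /pcode filter_map -map_comp. Qed.

Lemma ccode_flags r : {in r, forall y, y \in S} ->
  [seq t.2 | t <- ccode r & odflt true t.1] =
  [seq (z, tau z) | z <- cycles sg tau r & z \in S].
Proof.
elim: r => // y r IHr rS; rewrite -[ccode (y :: r)]/(ccode1 y ++ ccode r).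
rewrite -[cycles _ _ (y :: r)]/(orbit step y ++ cycles sg tau r) !filter_cat !map_cat.
rewrite IHr => [|z zr]; last by rewrite rS // inE zr orbT.
by congr (_ ++ _); rewrite orbit_traject /= rS ?mem_head //= filter_map -map_comp.
Qed.

Lemma pedges_sg y k : all (fun e => e.2 == sg e.1) (pedges (tau y) (pcode y k)).
Proof. by elim: k y => //= k IHk y; rewrite eqxx; apply: IHk. Qed.

Lemma cyc_edges_sg r : all (fun e => e.2 == sg e.1) (cyc_edges (ccode r)).
Proof.
elim: r => // y r IHr.
have gen n z : step (iter n step z) = y -> all (fun e => e.2 == sg e.1)
    (cedges y (tau z) ([seq (Some (w \in S), (w, tau w))
       | w <- traject step (step z) n] ++ ccode r)).
  elim: n z => [|n IHn] z zy; last first.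
    by rewrite /= eqxx; apply: IHn; rewrite -iterSr.
  have yz : y == sg (tau z) by rewrite -zy.
  by case: r IHr => [|y' r'] IHr; rewrite /= yz //; apply: IHr.
apply: gen; rewrite -iterS prednK ?order_gt0 // iter_order //.
exact: step_inj.
Qed.

End WalkEdges.

(** * Walk events at the two top levels, here [d] and [d.+1] for [d.+1] derived characters *)

Section Top.
Variables (k c d : nat).
Hypotheses (k_ge8 : (8 <= k)%N) (c_gt0 : (0 < c)%N).
Notation Sg := (Sigma k).
Notation K := (Key k c).
Notation U := (DTables k c d.+1).
Variable X : {set K}.
Hypothesis X_le : (#|X| <= #|{: Sg}| %/ 2)%N.
Implicit Types (T : U) (a : K) (E : seq (K * K)).
Implicit Types (PL : seq (bool * (K * K))) (CL : seq (option bool * (K * K))).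

Definition prs PL CL := [seq t.2 | t <- PL] ++ [seq t.2 | t <- CL].

Definition bprs PL CL :=
  [seq t.2 | t <- PL & t.1] ++ [seq t.2 | t <- CL & odflt true t.1].

(* The keys of a zero set sum to zero, so the last one is determined. *)
Definition mate a PL CL : K := a + \sum_(x <- flat (bprs PL CL)) x.

Definition wedges a PL CL := pedges (mate a PL CL) PL ++ cyc_edges CL.

Definition walk_in_X a PL CL := let l := flat ((a, mate a PL CL) :: prs PL CL) in
  uniq l && all (mem X) l.

(** The nesting follows the levels, zero set below [d], tau-pairs at [d], sigma-pairs at [d.+1], so
    that [card_satR] can peel them off from the top. *)
Definition walk_event a PL CL T :=
  [&& [&& walk_in_X a PL CL && (V T d (flat ((a, mate a PL CL) :: bprs PL CL)) == 0),
          ind T d (prs PL CL) & sat T d (prs PL CL)],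
      ind T d.+1 (wedges a PL CL) & sat T d.+1 (wedges a PL CL)].

Lemma size_wedges a PL CL : size (wedges a PL CL) = size (prs PL CL).
Proof. by rewrite !size_cat size_pedges size_cyc_edges !size_map. Qed.

Lemma bprs_mask PL CL : exists m, bprs PL CL = mask m (prs PL CL).
Proof.
exists ([seq t.1 | t <- PL] ++ [seq odflt true t.1 | t <- CL]).
rewrite /prs mask_cat ?size_map // /bprs !filter_mask !map_mask.
by congr (mask _ _ ++ mask _ _).
Qed.

(** [l] pairs of distinct keys of [X] satisfy [2l <= s/2], which is the size condition of
    [zero_set_bound]. *)
Lemma walk_in_X_size a PL CL : walk_in_X a PL CL ->
  ((size (prs PL CL)).+1.*2.*2 <= #|{: Sg}|)%N.
Proof.
move=> /andP[ul /allP lX]; have : (size (flat ((a, mate a PL CL) :: prs PL CL)) <= #|X|)%N.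
  by rewrite cardE; apply: uniq_leq_size => // x /lX; rewrite mem_enum.
rewrite size_flat /= => /leq_trans/(_ X_le).
move: (size _).+1 => m; rewrite -!muln2 => h.
by apply: leq_trans (leq_divM _ 2); rewrite leq_mul2r h orbT.
Qed.

Lemma card_walk_event (R : realFieldType) a PL CL : bprs PL CL != [::] ->
  #|[set T : U | walk_event a PL CL T]|%:R <=
  (#|{: Sg}|%:R ^- size (prs PL CL)) ^+ 2 * (G R (size (bprs PL CL)).+1 *
    ((3 / #|{: Sg}|%:R) ^+ d * #|{: U}|%:R)).
Proof.
move=> b0; rewrite expr2 -mulrA -{1}(size_wedges a).
apply: card_satR => // [T T' TT'|].
  have TT := agree_le (leqnSn d) TT'.
  by rewrite (agree_V c_gt0 TT) (agree_ind c_gt0 _ TT) (agree_sat c_gt0 _ _ TT').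
apply: card_satR => // [T T' TT'|]; first by rewrite (agree_V c_gt0 TT').
have [ok|nok] := boolP (walk_in_X a PL CL); last first.
  rewrite (_ : [set T | _] = set0) ?cards0; last by apply/setP => T; rewrite !inE.
  rewrite mulr_ge0 ?mulr_ge0 ?exprn_ge0 ?divr_ge0 ?ler0n //.
  by apply: le_trans ler01 (G_ge1 _ _); rewrite ltnS lt0n size_eq0.
have [m bm] := bprs_mask PL CL.
apply: le_trans (_ : #|[set T : U | V T d (flat ((a, mate a PL CL) :: bprs PL CL)) == 0]|%:R <= _).
  by rewrite ler_nat; apply/subset_leq_card/subsetP => T; rewrite !inE.
apply: zero_set_bound => //.
- case/andP: ok => ul _; apply: subseq_uniq ul.
  rewrite bm -[_ :: mask _ _]/(mask (true :: m) ((a, mate a PL CL) :: prs PL CL)).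
  exact: flat_mask_subseq.
- by rewrite size_flat.
- by rewrite ltnS lt0n size_eq0.
apply: leq_trans (walk_in_X_size ok); rewrite !leq_double ltnS bm.
by rewrite size_subseq // mask_subseq.
Qed.

(** The index [d.+2] covers all [c + d.+1] positions. *)
Definition bad T := [exists Z : {set K},
  [&& Z != set0, Z \subset X & V T d.+2 (enum Z) == 0]].

Lemma V_set T i (s : seq K) : uniq s -> V T i (enum [set x in s]) = V T i s.
Proof.
move=> us; apply: V_perm; apply: uniq_perm; rewrite ?enum_uniq // => x.
by rewrite mem_enum inE.
Qed.

(** A dependent subfamily of pairs agreeing at level [i] would be a zero set below level [i.+1] with
    fewer keys than [Z]. *)
Lemma ind_minimal T i (Z : {set K}) E : (i <= d.+1)%N ->
  (forall s : seq K, uniq s -> s != [::] -> {subset s <= Z} -> V T i.+1 s == 0 ->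
    (#|Z| <= size s)%N) ->
  uniq (flat E) -> {subset flat E <= Z} -> sat T i E -> (size (flat E) < #|Z|)%N ->
  ind T i E.
Proof.
move=> id Zmin; elim: E => // e E IHE uE EZ sE ltE; rewrite /=; apply/andP; split; last first.
  apply: IHE.
  - by move: uE => /and3P[].
  - by move=> x xE; apply: EZ; rewrite !inE xE !orbT.
  - by case/andP: sE.
  by apply: leq_ltn_trans ltE; rewrite !size_flat leq_double leqnSn.
apply/allP => m _; apply/negP => V0.
have sub : subseq (flat (e :: mask m E)) (flat (e :: E)).
  exact: (flat_mask_subseq (true :: m) (e :: E)).
have := Zmin (flat (e :: mask m E)) (subseq_uniq sub uE) isT.
move=> /(_ (fun x xs => EZ x (mem_subseq sub xs))).
have se : sat T i (e :: mask m E).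
  case/andP: sE => se sE; rewrite /sat /= se /=; apply/allP => f /mem_mask.
  exact: (allP sE).
move=> /(_ (sat_V0S c_gt0 id V0 se)); rewrite leqNgt => /negP[].
by apply: leq_ltn_trans ltE; apply: size_subseq.
Qed.

Lemma ind_not_dep T i (tau : K -> K) (l : seq K) : involutive tau -> uniq (vs tau l) ->
  ~~ dep tau (fun S => V T i (enum S) == 0) l -> ind T i [seq (z, tau z) | z <- l].
Proof.
move=> tauK; elim: l => // z l IHl ul nd; rewrite /=; apply/andP; split; last first.
  apply: IHl; first by move: ul => /and3P[].
  by apply: contraNN nd; apply: dep_sub => x xl; rewrite vs_cons !inE xl !orbT.
apply/allP => m _; apply: contraNN nd => V0.
have E : flat ((z, tau z) :: mask m [seq (z, tau z) | z <- l]) = vs tau (z :: mask m l).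
  by rewrite -map_mask.
rewrite E in V0.
have sub : subseq (vs tau (z :: mask m l)) (vs tau (z :: l)).
  rewrite -E -[_ :: mask _ _]/(mask (true :: m) [seq (z, tau z) | z <- z :: l]).
  exact: flat_mask_subseq.
apply/existsP; exists [set x in vs tau (z :: mask m l)]; apply/and4P; split.
- by apply/set0Pn; exists z; rewrite inE mem_vs // mem_head.
- by apply/subsetP => x; rewrite !in_set; apply: mem_subseq.
- by apply/forall_inP => x; rewrite !in_set; apply: vs_tau.
by rewrite V_set //; apply: subseq_uniq ul.
Qed.

Let rk (x : K) : nat := enum_rank x.

(** Minimality of the walk makes the tau-pairs after the first independent, and minimality of [Z]
    does the same for the sigma-pairs. The conditions on [PL] and [CL] record that the path ends in
    [S] and that cycles start in rank order. *)
Lemma bad_walk T : bad T -> exists a PL CL,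
  [/\ walk_event a PL CL T, bprs PL CL != [::],
      PL = [::] \/ exists M q, PL = rcons M (true, q),
      CL = [::] \/ exists q L, CL = (None, q) :: L
    & all (fun t => (t.1 == None) ==> (rk t.2.1 < rk t.2.2)%N) CL].
Proof.
move=> /existsP[Z1 Z1P].
pose P := [pred Z : {set K} | [&& Z != set0, Z \subset X & V T d.+2 (enum Z) == 0]].
case: (@arg_minnP _ Z1 P (fun Z => #|Z|) Z1P) => Z /and3P[Z0 ZX VZ] Zmin0.
have Zmin (s : seq K) : uniq s -> s != [::] -> {subset s <= Z} -> V T d.+2 s == 0 ->
    (#|Z| <= size s)%N.
  move=> us s0 sZ Vs; have -> : size s = #|[set x in s]|.
    by rewrite cardsE (card_uniqP us).
  apply: Zmin0; rewrite /P /= V_set // Vs andbT; apply/andP; split.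
    by case: s s0 {us sZ Vs} => // x s _; apply/set0Pn; exists x; rewrite inE mem_head.
  by apply: subset_trans ZX; apply/subsetP => x; rewrite inE; apply: sZ.
have even i : (i <= d.+1)%N -> forall b, ~~ odd (count (fun x => dk T x (c.-1 + i) == b) (enum Z)).
  by move=> id b; move/V0P: VZ; apply; lia.
have [sg [sgK sgP _]] := even_fibres_matching (enum_uniq Z) (even _ (leqnn _)).
have [tau [tauK tauP _]] := even_fibres_matching (enum_uniq Z) (even _ (leqnSn _)).
have sgZ x : x \in Z -> [/\ sg x \in Z, sg x != x
    & dk T (sg x) (c.-1 + d.+1) = dk T x (c.-1 + d.+1)].
  by move=> xZ; have := sgP x; rewrite !mem_enum; apply.
have tauZ x : x \in Z -> [/\ tau x \in Z, tau x != x
    & dk T (tau x) (c.-1 + d) = dk T x (c.-1 + d)].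
  by move=> xZ; have := tauP x; rewrite !mem_enum; apply.
have DZ : V T d (enum Z) == 0 by apply: V0_le VZ; lia.
have rk_inj : injective rk by move=> x y /val_inj/enum_rank_inj.
have [y [n [r [S [[us sZ nd] [Sl St DS] yS lastS rS]]]]] :=
  minimal_walk sgK tauK (fun x xZ => let: And3 h _ _ := sgZ x xZ in h)
    (fun x xZ => let: And3 h _ _ := tauZ x xZ in h)
    (fun x xZ => let: And3 _ h _ := sgZ x xZ in h)
    (fun x xZ => let: And3 _ h _ := tauZ x xZ in h)
    (Dp := fun S => V T d (enum S) == 0) rk_inj Z0 DZ.
pose PL := pcode sg tau S y n; pose CL := ccode sg tau S r.
have prsE : prs PL CL = [seq (z, tau z) | z <- behead (state sg tau y n r)].
  by rewrite /prs pcode_pairs ccode_pairs -map_cat.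
have bprsE : (y, tau y) :: bprs PL CL =
    [seq (z, tau z) | z <- [seq z <- state sg tau y n r | z \in S]].
  rewrite /bprs pcode_flags ccode_flags; last by move=> z /rS[].
  by rewrite -map_cat -filter_cat /= yS.
have subB : subseq (flat ((y, tau y) :: bprs PL CL)) (vs tau (state sg tau y n r)).
  by rewrite bprsE filter_mask map_mask; apply: flat_mask_subseq.
have uB := subseq_uniq subB us.
have pB : perm_eq (flat ((y, tau y) :: bprs PL CL)) (enum S).
  apply: uniq_perm; rewrite ?enum_uniq // => x; rewrite bprsE -/(vs tau _).
  rewrite mem_enum mem_vs // !mem_filter; apply/orP/idP => [[/andP[]//|/andP[txS _]]|xS].
    by rewrite -[x]tauK St.
  by have /subsetP/(_ x xS) := Sl; rewrite inE mem_vs // xS St //= => /orP.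
have stZ z : z \in state sg tau y n r -> z \in Z by apply: sZ.
have sat_tau (l : seq K) : {subset l <= Z} -> sat T d [seq (z, tau z) | z <- l].
  move=> lZ; apply/allP => e /mapP[z /lZ zZ ->] /=.
  by have [_ _ ->] := tauZ z zZ.
have VB : V T d (flat ((y, tau y) :: bprs PL CL)) == 0 by rewrite (V_perm T d pB).
have VB1 : V T d.+1 (flat ((y, tau y) :: bprs PL CL)) == 0.
  apply: sat_V0S => //; rewrite bprsE; apply: sat_tau => z.
  by rewrite mem_filter => /andP[_ /stZ].
have K_opp (x : K) : - x = x by apply/ffunP => j; rewrite ffunE; apply: F2_opp.
have mateE : mate y PL CL = tau y.
  have := V0_sum0 c_gt0 (ltn_addr _ c_gt0) (V0_le (ltn0Sn d) VB1).
  rewrite flat_cons /= !big_cons /mate => /eqP; rewrite addrCA addr_eq0 K_opp.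
  by move=> /eqP.
have inX : walk_in_X y PL CL.
  have -> : walk_in_X y PL CL = uniq (vs tau (state sg tau y n r)) &&
      all (mem X) (vs tau (state sg tau y n r)) by rewrite /walk_in_X mateE prsE.
  rewrite us; apply/allP => x.
  move=> /(vs_sub tauK (fun x xZ => let: And3 h _ _ := tauZ x xZ in h) sZ).
  exact: (subsetP ZX).
have [z0 pW] : exists z0, perm_eq (z0 :: flat (wedges y PL CL)) (tau y :: flat (prs PL CL)).
  have [z0 pz] := perm_pedges (tau y) PL; exists z0.
  rewrite /wedges /prs mateE !flat_cat -!cat_cons.
  by apply: perm_cat => //; apply: perm_cyc_edges.
have uW : uniq (flat (wedges y PL CL)).
  have : uniq (tau y :: flat (prs PL CL)).
    by move: us; rewrite prsE /state vs_cons => /andP[].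
  by rewrite -(perm_uniq pW) => /andP[].
have WZ : {subset flat (wedges y PL CL) <= Z}.
  move=> x xW; apply: (vs_sub tauK (fun x xZ => let: And3 h _ _ := tauZ x xZ in h) sZ).
  rewrite /state vs_cons in_cons; apply/orP; right.
  by move: (perm_mem pW x); rewrite prsE in_cons xW orbT => <-.
have sW : sat T d.+1 (wedges y PL CL).
  have : all (fun e => e.2 == sg e.1) (wedges y PL CL).
    by rewrite /wedges all_cat mateE pedges_sg cyc_edges_sg.
  move=> /allP eW; apply/allP => e ew; have /eqP -> := eW e ew.
  have eZ : e.1 \in Z.
    by apply: WZ; apply/flatten_mapP; exists e; rewrite // mem_head.
  by have [_ _ ->] := sgZ _ eZ.
exists y, PL, CL; split.
- apply/and3P; split=> //; last first.
    (* The edges omit the starting key [y] and the far end [z0], so they cover fewer keys than [Z]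
       has. *)
    apply: (@ind_minimal T d.+1 Z) => //.
    rewrite size_flat size_wedges.
    have : (size (vs tau (state sg tau y n r)) <= #|Z|)%N.
      rewrite cardE; apply: uniq_leq_size => // x.
      move=> /(vs_sub tauK (fun x xZ => let: And3 h _ _ := tauZ x xZ in h) sZ).
      by rewrite mem_enum.
    by rewrite size_vs /= prsE size_map; apply: leq_trans; rewrite ltn_double.
  apply/and3P; split; first by rewrite inX mateE.
    by rewrite prsE; apply: ind_not_dep => //; move: us => /and3P[].
  by rewrite prsE; apply: sat_tau => z zb; apply: stZ; apply: mem_behead.
(* Otherwise [y] and [tau y] alone would form a zero set. *)
- apply/negP => /eqP b0; move: VB1 uB; rewrite b0 => /(V0_le (ltn0Sn d)).
  by move=> /(no_pair c_gt0 (ltn_addr _ c_gt0)) /= <-; rewrite inE eqxx.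
- rewrite /PL /pcode; case: (n) lastS => [|n'] lastS; first by left.
  right; rewrite trajectSr map_rcons -iterSr lastS //.
  by eexists; eexists.
- by rewrite /CL /ccode; case: (r) => [|z r']; [left | right; eexists; eexists].
apply/allP => t /flatten_mapP[z zr]; rewrite inE => /orP[/eqP->|/mapP[w _ ->]] //=.
by have [_] := rS z zr.
Qed.

End Top.

Lemma ler_of_eq (R : realFieldType) (x z : R) : x = z -> x <= z.
Proof. by move->. Qed.

Lemma geometric_le (R : realFieldType) (v b : R) m : 0 <= v -> v <= b -> b < 1 ->
  \sum_(0 <= i < m) v ^+ i <= (1 - b)^-1.
Proof.
move=> v0 vb b1; have b1' : 0 < 1 - b by lra.
elim: m => [|m IHm]; first by rewrite big_nil invr_ge0 ltW.
rewrite big_nat_recl // expr0; under eq_bigr => i _ do rewrite exprS.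
rewrite -mulr_sumr; have S0 : 0 <= \sum_(0 <= i < m) v ^+ i.
  by apply: sumr_ge0 => i _; apply: exprn_ge0.
have -> : (1 - b)^-1 = 1 + b * (1 - b)^-1 by field; lra.
by rewrite lerD2l; apply: ler_pM.
Qed.

(** [115/12 = 23/4 * 5/3]: path and cycles each set one flagged pair aside, which leaves the
    exponent [a + b + 1] in [G]. *)
Lemma cross_term (R : realFieldType) (w : R) i j a b : 0 <= w ->
  w ^+ (i.+1 + j.+1) * G R (a.+1 + b.+1).+1 <=
  w * (115 / 12 * (w * (w ^+ i * (5 / 3) ^+ a))) * (w ^+ j * (5 / 3) ^+ b).
Proof.
move=> w0; rewrite addSn addnS; have Gm := @G_le R (a + b).+3 isT.
rewrite subSS subSS subn0 in Gm; rewrite addSn addnS.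
apply: le_trans (ler_wpM2l (exprn_ge0 _ w0) Gm) _; rewrite !exprS !exprD.
move: (w ^+ i) (w ^+ j) ((5 / 3) ^+ a) ((5 / 3) ^+ b) => wi wj ga gb.
by apply: ler_of_eq; field.
Qed.

(** * Summation over walks *)

Section Sum.
Variables (R : realFieldType) (k c d : nat).
Hypotheses (k_ge8 : (8 <= k)%N) (c_gt0 : (0 < c)%N).
Notation Sg := (Sigma k).
Notation K := (Key k c).
Notation U := (DTables k c d.+1).
Variable X : {set K}.
Hypothesis X_le : (#|X| <= #|{: Sg}| %/ 2)%N.
Implicit Types (PL : seq (bool * (K * K))) (CL : seq (option bool * (K * K))).
Notation rk x := (nat_of_ord (enum_rank x)).
Let n := #|X|.
Let s : R := #|{: Sg}|%:R.
(** [w] is the price of a tau-pair with its sigma-edge, and [y] the total price over the [n^2]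
    choices of a pair. *)
Let w := s^-1 ^+ 2.
Let y := n%:R ^+ 2 * w.

Let s256 : 256 <= s. Proof. exact: card_Sigma_ge. Qed.
Let w0 : 0 <= w. Proof. by rewrite exprn_ge0 // invr_ge0 ler0n. Qed.
Let y0 : 0 <= y. Proof. by apply: mulr_ge0 w0; rewrite exprn_ge0 ?ler0n. Qed.
Let y4 : y <= 1 / 4.
Proof.
have s0 : 0 < s by have := s256; lra.
have ns : n%:R <= s / 2.
  rewrite ler_pdivlMr // -natrM ler_nat.
  by apply: leq_trans (leq_divM _ 2); rewrite leq_mul2r X_le orbT.
have q0 : 0 <= n%:R / s by rewrite divr_ge0 ?ler0n //; lra.
have q2 : n%:R / s <= 1 / 2 by rewrite ler_pdivrMr //; lra.
rewrite /y /w -exprMn expr2; nra.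
Qed.

Let pow_ge0 i j : 0 <= w ^+ i * (5 / 3) ^+ j.
Proof. by apply: mulr_ge0; apply: exprn_ge0; [exact: w0 | lra]. Qed.

Definition pairX := [seq (x, z) | x <- enum X, z <- enum X].
Definition opairX := [seq p <- pairX | (rk p.1 < rk p.2)%N].
Definition pathX := [seq (b, p) | b <- [:: true; false], p <- pairX].
Definition cycX := [seq (Some b, p) | b <- [:: true; false], p <- pairX] ++
  [seq (None, p) | p <- opairX].
Definition LP := flatten [seq [seq rcons M (true, q) | M <- lists pathX i, q <- pairX]
  | i <- index_iota 0 n.+1].
Definition LC := flatten [seq [seq (None, q) :: L | L <- lists cycX i, q <- opairX]
  | i <- index_iota 0 n.+1].

Lemma size_pairX : (size pairX)%:R = n%:R ^+ 2 :> R.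
Proof. by rewrite size_allpairs -cardE natrM expr2. Qed.

Lemma size_opairX : (size opairX)%:R <= n%:R ^+ 2 / 2 :> R.
Proof.
have E : (size opairX = \sum_(x <- enum X) \sum_(z <- enum X) (rk x < rk z))%N.
  rewrite size_filter -sum1_count big_mkcond /pairX big_allpairs_dep /=.
  by apply: eq_bigr => x _; apply: eq_bigr => z _; case: ltnP.
have : (size opairX + size opairX <= n * n)%N.
  rewrite {1}E [X in (_ + X <= _)%N]E [X in (_ + X <= _)%N]exchange_big -big_split /=.
  rewrite {1}/n cardE -sum1_size big_distrl /=; apply: leq_sum => x _.
  rewrite mul1n -big_split /= /n cardE -sum1_size; apply: leq_sum => z _.
  by case: ltngtP.
by rewrite -(ler_nat R) natrD natrM expr2; lra.
Qed.

(** A pair in the dependent set also carries the growth rate 5/3 of [G], which makes the cost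
    essentially multiplicative. *)
Let fP (t : bool * (K * K)) : R := w * (if t.1 then 5 / 3 else 1).
Let fC (t : option bool * (K * K)) : R := w * (if odflt true t.1 then 5 / 3 else 1).

Lemma prod_fP PL : \prod_(t <- PL) fP t = w ^+ size PL * (5 / 3) ^+ count fst PL.
Proof.
elim: PL => [|t PL IH]; first by rewrite big_nil mulr1.
by rewrite big_cons IH /fP /= exprS; case: t.1 => /=; rewrite ?add1n ?exprS; ring.
Qed.

Lemma prod_fC CL : \prod_(t <- CL) fC t =
  w ^+ size CL * (5 / 3) ^+ count (fun t => odflt true t.1) CL.
Proof.
elim: CL => [|t CL IH]; first by rewrite big_nil mulr1.
by rewrite big_cons IH /fC /= exprS; case: (odflt true t.1) => /=; rewrite ?add1n ?exprS; ring.
Qed.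

Lemma big_const (I : Type) (r : seq I) (x : R) : \sum_(i <- r) x = (size r)%:R * x.
Proof. by rewrite big_const_seq count_predT iter_addr addr0 mulr_natl. Qed.

Let vP : R := y * (8 / 3).
Let vC : R := \sum_(t <- cycX) fC t.

Lemma sum_fP : \sum_(t <- pathX) fP t = vP.
Proof.
rewrite /pathX big_allpairs_dep /= !big_cons big_nil addr0 /fP /= !big_const size_pairX.
by rewrite /vP /y; field.
Qed.

Lemma vC_ge0 : 0 <= vC.
Proof. by apply: sumr_ge0 => t _; rewrite mulr_ge0 //; case: ifP => _; lra. Qed.

(** Continuing pairs contribute [(5/3 + 1) * y] and starting pairs at most [5/3 * y/2], in all
    [7/2 * y], with [y <= 1/4]. *)
Lemma vC_le : vC <= 7 / 8.
Proof.
rewrite /vC /cycX big_cat big_allpairs_dep big_map /= !big_cons big_nil addr0 /fC /= !big_const.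
rewrite size_pairX; have := size_opairX; move: y4; rewrite /y => h1 h2.
have := ler_wpM2r w0 h2; lra.
Qed.

Lemma sum_LP (F : seq (bool * (K * K)) -> R) (a : nat -> R) :
  (forall M q, F (rcons M (true, q)) <= w * a (size M) * \prod_(t <- M) fP t) ->
  \sum_(PL <- LP) F PL <= y * \sum_(0 <= i < n.+1) a i * vP ^+ i.
Proof.
move=> Fa; rewrite big_flatten big_map mulr_sumr /=; apply: ler_sum => i _.
rewrite big_allpairs_dep /= -sum_fP -sum_lists !mulr_sumr big_seq [leRHS]big_seq.
apply: ler_sum => M; rewrite mem_lists => /andP[/eqP <- _].
apply: le_trans (ler_sum _ (fun q _ => Fa M q)) _.
by rewrite big_const size_pairX /y; apply: ler_of_eq; ring.
Qed.

Lemma sum_LC (F : seq (option bool * (K * K)) -> R) (a : nat -> R) :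
  (forall i, 0 <= a i) ->
  (forall L q, F ((None, q) :: L) <= w * a (size L) * \prod_(t <- L) fC t) ->
  \sum_(CL <- LC) F CL <= y / 2 * \sum_(0 <= i < n.+1) a i * vC ^+ i.
Proof.
move=> a0 Fa; rewrite big_flatten big_map mulr_sumr /=; apply: ler_sum => i _.
rewrite big_allpairs_dep /= /vC -sum_lists !mulr_sumr big_seq [leRHS]big_seq.
apply: ler_sum => L; rewrite mem_lists => /andP[/eqP <- _].
apply: le_trans (ler_sum _ (fun q _ => Fa L q)) _.
rewrite big_const; apply: le_trans (ler_wpM2r _ size_opairX) _.
  apply: mulr_ge0; first exact: mulr_ge0.
  by rewrite prod_fC pow_ge0.
by rewrite /y; apply: ler_of_eq; field.
Qed.

Let cost PL CL := (s ^- size (prs PL CL)) ^+ 2 * G R (size (bprs PL CL)).+1.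

Lemma costE PL CL : cost PL CL = w ^+ (size PL + size CL) *
  G R (count fst PL + count (fun t => odflt true t.1) CL).+1.
Proof.
rewrite /cost /prs /bprs !size_cat !size_map !size_filter; congr (_ * _).
by rewrite /w -exprVn -!exprM mulnC.
Qed.

(** Prefactor of [G] when one flagged pair is set aside and [i] pairs remain; for [i = 0] only
    [G 2 = 1] occurs. *)
Let a1 (i : nat) : R := if i == 0%N then 1 else 23 / 4.

Lemma sum_a1 v b : 0 <= v -> v <= b -> b < 1 ->
  \sum_(0 <= i < n.+1) a1 i * v ^+ i <= 23 / 4 * (1 - b)^-1 - 19 / 4.
Proof.
move=> v0 vb b1; have := geometric_le n.+1 v0 vb b1.
rewrite !big_nat_recl // !expr0 /a1 /= -mulr_sumr; lra.
Qed.

Lemma G_a1 m cnt : (cnt <= m)%N -> G R cnt.+2 <= a1 m * (5 / 3) ^+ cnt.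
Proof.
case: m => [|m]; first by rewrite leqn0 => /eqP->; rewrite /a1 /G /= mulr1.
by move=> _; have := G_le R (isT : (1 < cnt.+2)%N); rewrite subSS subSS subn0.
Qed.

(** A path alone, cycles alone and both together contribute at most [25/2], [165/8] and [115/4]
    times [y]; the sum of the three is below 63. *)
Lemma cost_sum : \sum_(PL <- LP) cost PL [::] + (\sum_(CL <- LC) cost [::] CL +
  \sum_(PL <- LP) \sum_(CL <- LC) cost PL CL) <= 63 * y.
Proof.
have y_ge0 := y0; have y_le := y4.
have vP0 : 0 <= vP by rewrite /vP; lra.
have vP2 : vP <= 2 / 3 by rewrite /vP; lra.
have i3 : (1 - 2 / 3)^-1 = 3 :> R by field.
have i8 : (1 - 7 / 8)^-1 = 8 :> R by field.
have b3 : 2 / 3 < 1 :> R by lra.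
have b8 : 7 / 8 < 1 :> R by lra.
have h1 : \sum_(PL <- LP) cost PL [::] <= y * (25 / 2).
  apply: le_trans (sum_LP (a := a1) _) _ => [M q|].
    rewrite costE prod_fP size_rcons addn0 -cats1 count_cat /= !addn0 addn1 exprS -mulrA.
    have wM : 0 <= w ^+ size M by apply: exprn_ge0.
    apply: le_trans (ler_wpM2l w0 (ler_wpM2l wM (G_a1 (count_size fst M)))) _.
    by apply: ler_of_eq; ring.
  rewrite ler_wpM2l //; apply: le_trans (sum_a1 vP0 vP2 b3) _; rewrite i3; lra.
have h2 : \sum_(CL <- LC) cost [::] CL <= y / 2 * (165 / 4).
  apply: le_trans (sum_LC (a := a1) _ _) _ => [i|L q|].
  - by rewrite /a1; case: ifP => _; lra.
  - rewrite costE prod_fC /= !add0n add1n exprS -mulrA.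
    have wL : 0 <= w ^+ size L by apply: exprn_ge0.
    apply: le_trans (ler_wpM2l w0 (ler_wpM2l wL (G_a1 (count_size _ L)))) _.
    by apply: ler_of_eq; ring.
  rewrite ler_wpM2l //; first by lra.
  by apply: le_trans (sum_a1 vC_ge0 vC_le b8) _; rewrite i8; lra.
have h3 : \sum_(PL <- LP) \sum_(CL <- LC) cost PL CL <= y * (y / 2 * (230)).
  have := geometric_le n.+1 vC_ge0 vC_le b8; rewrite i8 => g8.
  have := geometric_le n.+1 vP0 vP2 b3; rewrite i3 => g3.
  pose D := 115 / 12 * (y / 2 * 8).
  apply: le_trans (sum_LP (a := fun=> D) _) _ => [M q|]; last first.
    rewrite -mulr_sumr ler_wpM2l //; apply: le_trans (_ : D * 3 <= _); last first.
      by rewrite /D; lra.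
    by apply: ler_wpM2l g3; rewrite /D; lra.
  pose e := 115 / 12 * (w * \prod_(t <- M) fP t).
  have P0 : 0 <= \prod_(t <- M) fP t.
    by rewrite prod_fP pow_ge0.
  have e0 : 0 <= e by apply: mulr_ge0; [lra | exact: mulr_ge0].
  apply: le_trans (sum_LC (a := fun=> e) _ _) _ => [i|L q'|] //.
    rewrite costE prod_fC size_rcons /e prod_fP -cats1 count_cat [count fst [:: _]]/=.
    by rewrite addn0 addn1 [size (_ :: L)]/= [count _ (_ :: L)]/= add1n; apply: cross_term.
  rewrite -mulr_sumr; apply: le_trans (_ : y / 2 * (e * 8) <= _).
    apply: ler_wpM2l; first by lra.
    exact: ler_wpM2l g8.
  rewrite /e /D; apply: ler_of_eq; move: (\prod_(t <- M) fP t) w y => P' w' y'.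
  by field.
have h4 : y * (y / 2 * 230) <= y * (115 / 4) by apply: ler_wpM2l; lra.
by lra.
Qed.

Lemma mem_pairX p : (p \in pairX) = (p.1 \in X) && (p.2 \in X).
Proof.
case: p => x z /=; rewrite -!(mem_enum X).
by apply/allpairsP/andP => [[[x' z'] [/= hx hz [-> ->]]]//|[hx hz]]; exists (x, z).
Qed.

Lemma mem_opairX p : (p \in opairX) = (rk p.1 < rk p.2)%N && (p \in pairX).
Proof. by rewrite mem_filter. Qed.

Lemma LP_flag PL : PL \in LP -> (0 < count fst PL)%N.
Proof.
move=> /flatten_mapP[i _ /allpairsP[[M q] [_ _ ->]]].
by rewrite -has_count has_rcons.
Qed.

Lemma LC_flag CL : CL \in LC -> (0 < count (fun t => odflt true t.1) CL)%N.
Proof. by move=> /flatten_mapP[i _ /allpairsP[[L q] [_ _ ->]]]. Qed.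

Lemma bprs_neq0 PL CL :
  (0 < count fst PL + count (fun t => odflt true t.1) CL)%N -> bprs PL CL != [::].
Proof. by rewrite -size_eq0 size_cat !size_map !size_filter lt0n. Qed.

Definition codes := [seq (PL, [::]) | PL <- LP] ++ ([seq ([::], CL) | CL <- LC] ++
  [seq (PL, CL) | PL <- LP, CL <- LC]).

(** A walk in [X] has distinct keys, so its code has at most [n] pairs and occurs in the finite
    list. *)
Lemma bad_code (T : U) : bad X T ->
  has (fun i => walk_event X i.1 i.2.1 i.2.2 T) [seq (a, w) | a <- enum X, w <- codes].
Proof.
move=> /(bad_walk k_ge8 c_gt0 X_le)[a [PL [CL [ev b0 shP shC oC]]]].
apply/hasP; exists (a, (PL, CL)) => //.
have /andP[/and3P[/andP[/andP[ul /allP lX] _] _ _] _] := ev.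
have aX : a \in X by apply: lX; rewrite mem_head.
have pX p : p \in prs PL CL -> p \in pairX.
  move=> pp; rewrite mem_pairX; apply/andP; split; apply: lX;
    apply/flatten_mapP; exists p; rewrite ?inE ?pp ?eqxx ?orbT //.
have sz : (size (prs PL CL) < n.+1)%N.
  have : (size (flat ((a, mate a PL CL) :: prs PL CL)) <= size (enum X))%N.
    by apply: uniq_leq_size => // x /lX; rewrite mem_enum.
  rewrite -cardE size_flat ltnS; apply: leq_trans.
  by rewrite /= doubleS -addnn; move: (size _) => m; clear; lia.
have memP : PL = [::] \/ PL \in LP.
  case: shP => [->|[M [q EP]]]; [by left | right].
  apply/flatten_mapP; exists (size M).
    rewrite mem_index_iota /=; apply: leq_ltn_trans sz.
    by rewrite /prs EP size_cat !size_map size_rcons addSn -addnS leq_addr.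
  rewrite EP; apply/allpairsP; exists (M, q); split=> //=.
    rewrite mem_lists eqxx /=; apply/allP => -[b p] tM /=.
    apply/allpairsP; exists (b, p); split=> //=; first by case: b {tM}.
    apply: pX; rewrite mem_cat EP; apply/orP; left; apply/mapP; exists (b, p) => //.
    by rewrite mem_rcons inE tM orbT.
  apply: pX; rewrite mem_cat EP; apply/orP; left; apply/mapP; exists (true, q) => //.
  by rewrite mem_rcons mem_head.
have pC t : t \in CL -> t.2 \in pairX.
  by move=> tC; apply: pX; rewrite mem_cat; apply/orP; right; apply/mapP; exists t.
have oX t : t \in CL -> t.1 = None -> t.2 \in opairX.
  by move=> tC t1; rewrite mem_opairX pC // andbT; have /implyP := allP oC t tC; apply; rewrite t1.
have memC : CL = [::] \/ CL \in LC.
  case: shC => [->|[q [L EC]]]; [by left | right].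
  apply/flatten_mapP; exists (size L).
    rewrite mem_index_iota /=; apply: leq_ltn_trans sz.
    by rewrite /prs EC size_cat !size_map /= addnS -addSn leq_addl.
  rewrite {1}EC; apply/allpairsP; exists (L, q); split=> //=; last first.
    by apply: (oX (None, q)); rewrite // EC mem_head.
  rewrite mem_lists eqxx /=; apply/allP => -[[b|] p] tM; rewrite /= mem_cat; apply/orP.
    left; apply/allpairsP; exists (b, p); split=> //=; first by case: b {tM}.
    by apply: (pC (Some b, p)); rewrite EC inE tM orbT.
  right; apply/mapP; exists p => //.
  by apply: (oX (None, p)); rewrite // EC inE tM orbT.
apply/allpairsP; exists (a, (PL, CL)); split=> //=; first by rewrite mem_enum.
rewrite !mem_cat; case: memP b0 => [->|PLP]; case: memC => [->|CLC] // _.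
- by apply/orP; right; apply/orP; left; apply/mapP; exists CL.
- by apply/orP; left; apply/mapP; exists PL.
by apply/orP; right; apply/orP; right; apply/allpairsP; exists (PL, CL).
Qed.

(** The first key [a] has [n] choices, its mate is determined, and the rest costs [63 * y]; hence
    [n^3] over [s^2]. *)
Lemma card_bad : #|[set T : U | bad X T]|%:R <=
  63 * n%:R ^+ 3 / s ^+ 2 * ((3 / s) ^+ d * #|{: U}|%:R).
Proof.
set C := _ * #|_|%:R.
have C0 : 0 <= C by rewrite mulr_ge0 ?exprn_ge0 ?divr_ge0 ?ler0n.
have := union_bound bad_code; rewrite -(ler_nat R) => /le_trans; apply.
rewrite natr_sum big_allpairs_dep /=.
have le1 a PL CL : (0 < count fst PL + count (fun t => odflt true t.1) CL)%N ->
    #|[set T : U | walk_event X a PL CL T]|%:R <= cost PL CL * C.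
  by move=> h; rewrite /cost -mulrA; apply: card_walk_event => //; apply: bprs_neq0.
apply: le_trans (_ : \sum_(a <- enum X) 63 * y * C <= _); last first.
  rewrite big_const -cardE -/n; apply: ler_of_eq; rewrite /y /w -exprVn.
  by move: (C) (n%:R) (s^-1) => C' n' s'; ring.
apply: ler_sum => a _; rewrite !big_cat !big_map big_allpairs_dep /=.
apply: le_trans (ler_wpM2r C0 cost_sum); rewrite !mulrDl !mulr_suml.
apply: lerD; last apply: lerD.
- rewrite big_seq [leRHS]big_seq; apply: ler_sum => PL /LP_flag h.
  by apply: le1; rewrite addn0.
- by rewrite big_seq [leRHS]big_seq; apply: ler_sum => CL /LC_flag h; apply: le1.
rewrite big_seq [leRHS]big_seq; apply: ler_sum => PL /LP_flag h.
by rewrite mulr_suml; apply: ler_sum => CL _; apply: le1; rewrite ltn_addr.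
Qed.

End Sum.

(** * Uniformity in the absence of zero sets *)

Section Uniform.
Variables (k r c d : nat).
Notation K := (Key k c).
Notation I := ('I_(c + d) * Sigma k)%type.
Variables (T : DTables k c d) (X : {set K}).
Implicit Types (H : HTables k r c d) (x : K).

Lemma tornado_vec H x :
  tornado T H x = \sum_(pa : I) vec T d.+1 x pa *: H pa.1 pa.2.
Proof.
rewrite /tornado /hhat; transitivity (\sum_p \sum_a vec T d.+1 x (p, a) *: H p a); last first.
  by rewrite pair_bigA; apply: eq_bigr => -[].
apply: eq_bigr => p _; rewrite ffunE -/(dk T x p) (bigD1 (dk T x p)) //= ffunE /= eqxx.
have -> : (p + 1 < c + d.+1)%N by have := ltn_ord p; lia.
rewrite scale1r big1 ?addr0 // => a ap.
by rewrite ffunE /= [_ == a]eq_sym (negbTE ap) andbF scale0r.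
Qed.

Lemma tornadoD H1 H2 x : tornado T (H1 + H2) x = tornado T H1 x + tornado T H2 x.
Proof. by rewrite -big_split; apply: eq_bigr => p _; rewrite !ffunE. Qed.

Hypothesis X_free : forall Z : {set K}, Z != set0 -> Z \subset X ->
  V T d.+1 (enum Z) != 0.

Let fam : {ffun 'I_#|X| -> {ffun I -> 'F_2}} :=
  [ffun i => vec T d.+1 (enum_val i)].

Let fam_free (a : 'I_#|X| -> 'F_2) :
  (forall j, \sum_i a i * fam i j = 0) -> forall i, a i = 0.
Proof.
move=> a0 i; apply/eqP/negPn/negP => ai.
pose Z := [set enum_val i | i : 'I_#|X| & a i != 0].
have Z0 : Z != set0 by apply/set0Pn; exists (enum_val i); apply/imsetP; exists i; rewrite ?inE.
have ZX : Z \subset X by apply/subsetP => x /imsetP[j _ ->]; apply: enum_valP.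
have /negP[] := X_free Z0 ZX; apply/eqP/ffunP => ps; rewrite [RHS]ffunE -[RHS](a0 ps).
rewrite /V sum_ffunE big_enum /= big_imset /=; last by move=> u v _ _; apply: enum_val_inj.
rewrite [LHS](eq_bigl (fun j => a j != 0)) => [|j]; last by rewrite inE.
rewrite big_mkcond; apply: eq_bigr => j _.
by rewrite -[RHS]/(a j *: (_ : ('F_2)^o)) F2_scale [fam j]ffunE.
Qed.

Let sh (u : {ffun 'I_#|X| -> Rng r}) : HTables k r c d :=
  [ffun p => [ffun a => dual fam u (p, a)]].

Let tornado_sh u i : tornado T (sh u) (enum_val i) = u i.
Proof.
rewrite tornado_vec -[RHS](dualE u fam_free).
by apply: eq_bigr => -[p a] _; rewrite [fam i]ffunE !ffunE.
Qed.

(** Adding [sh u] shifts the hash values on [X] by [u]. Thus solutions for [f] paired with all [u]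
    are in bijection with all tables, [u] being recovered as the deviation from [f]. *)
Lemma zero_free_fully_random : fully_random_on r T X.
Proof.
move=> f; set Y := [set H | _].
have -> : (#|{: Rng r}| ^ #|X| = #|[set: {ffun 'I_#|X| -> Rng r}]|)%N.
  by rewrite cardsT card_ffun card_ord.
rewrite -cardsX -[RHS]cardsT.
pose g (Hu : HTables k r c d * {ffun 'I_#|X| -> Rng r}) := Hu.1 + sh Hu.2.
have YP H : reflect (forall i : 'I_#|X|, tornado T H (enum_val i) = f (enum_val i)) (H \in Y).
  rewrite inE; apply: (iffP forall_inP) => [h i|h x xX]; first by apply/eqP/h/enum_valP.
  by rewrite -(enum_rankK_in xX xX) h.
have g_inj : {in setX Y setT &, injective g}.
  move=> [H u] [H' u']; rewrite !in_setX !in_setT !andbT /= => /YP hH /YP hH' gg.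
  have uu : u = u'.
    apply/ffunP => i; have := congr1 (fun H => tornado T H (enum_val i)) gg.
    by rewrite /g /= !tornadoD hH hH' !tornado_sh => /addrI.
  by move: gg; rewrite /g /= uu => /addIr ->.
rewrite -(card_in_imset g_inj); congr #|pred_of_set _|; apply/setP => H.
rewrite in_setT; apply/imsetP.
pose u := [ffun i : 'I_#|X| => tornado T H (enum_val i) - f (enum_val i)].
have hE : H = (H - sh u) + sh u by rewrite subrK.
exists (H - sh u, u) => //; rewrite in_setX in_setT andbT; apply/YP => i.
apply: (@addIr _ (u i)); rewrite -{1}(tornado_sh u i) -tornadoD subrK ffunE.
by rewrite addrC subrK.
Qed.

End Uniform.

(** * From counts of bad tables to the probability bound *)

Lemma good_fraction (R : realFieldType) (N s n b p : R) d :
  0 < N -> 0 < s -> 0 <= p -> b <= 63 * n ^+ 3 / s ^+ 2 * ((3 / s) ^+ d * N) ->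
  1 - 7 * n ^+ 3 * (3 / s) ^+ d.+2 - p <= (N - b) / N.
Proof.
move=> N0 s0 p0 hb; rewrite ler_pdivlMr // !mulrBl mul1r.
have -> : 7 * n ^+ 3 * (3 / s) ^+ d.+2 * N = 63 * n ^+ 3 / s ^+ 2 * ((3 / s) ^+ d * N).
  rewrite !exprS; move: (_ ^+ d) => q; field.
  by rewrite gt_eqF.
have := mulr_ge0 p0 (ltW N0); lra.
Qed.

Theorem theorem1p1 (k r c d : nat) (hk : (8 <= k)%N) (hc : (1 <= c)%N)
  (hd : (1 <= d)%N) (X : {set Key k c})
  (hX : (#|X| <= #|{: Sigma k}| %/ 2)%N) :
  exists E : {set DTables k c d},
    (#|E|%:R / #|{: DTables k c d}|%:R : rat)
      >= 1 - 7 * (#|X| ^ 3)%:R * (3 / #|{: Sigma k}|%:R) ^+ d.+1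
           - 1 / (2 ^ (#|{: Sigma k}| %/ 2))%:R
    /\ forall T, T \in E -> fully_random_on r T X.
Proof.
(* The good event is the absence of zero sets in [X]; the new [d] is one less than the number of
   derived characters, as in [bad]. *)
case: d hd => // d _; exists (~: [set T | bad X T]); split; last first.
  move=> T; rewrite !inE => nbad; apply: zero_free_fully_random => Z Z0 ZX.
  by apply: contraNN nbad => VZ; apply/existsP; exists Z; rewrite Z0 ZX.
have le_bad := card_bad rat d hk hc hX.
have -> : #|~: [set T : DTables k c d.+1 | bad X T]|%:R =
    #|{: DTables k c d.+1}|%:R - #|[set T : DTables k c d.+1 | bad X T]|%:R :> rat.
  by rewrite [#|~: _|]cardsCs setCK natrB // max_card.
rewrite natrX; apply: good_fraction le_bad.
- by rewrite ltr0n; apply/card_gt0P; exists 0.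
- by rewrite ltr0n; apply/card_gt0P; exists 0.
- exact: divr_ge0 ler01 (ler0n _ _).
Qed.
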